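(* The Gabidulin index $\mathrm{ind}(\mathcal C)$ and the value $h(\mathcal C)$ of the following $\mathbb F_{q^n}$-linear MRD codes $\mathcal C\subseteq\mathcal L_{n,q}$ of dimension $k$ are: (a) $\mathcal G_{k,s}=\langle x,x^{[s]},\ldots,x^{[s(k-1)]}\rangle_{\mathbb F_{q^n}}$ ($\gcd(s,n)=1$, $1\le k<n$): $\mathrm{ind}=k$, $h=k-1$; (b) $\mathcal H_{k,s}(\eta)=\langle x+\eta x^{[sk]},x^{[s]},\ldots,x^{[s(k-1)]}\rangle_{\mathbb F_{q^n}}$ ($\gcd(s,n)=1$, $1<k<n-1$, $\eta\ne0$, $\mathrm N_{q^n/q}(\eta)\ne(-1)^{nk}$): $\mathrm{ind}=k-1$, $h=k-2$; (c) $n=6$, $\mathcal C_1=\langle x,\delta x^{[1]}+x^{[4]}\rangle_{\mathbb F_{q^6}}$ ($q>4$, $\delta\in\mathbb F_{q^6}$ such that $\mathcal C_1$ is MRD): $\mathrm{ind}=1$, $h=0$; (d) $n=6$, $\mathcal C_2=\langle x,x^{[1]}+x^{[3]}+\delta x^{[5]}\rangle_{\mathbb F_{q^6}}$ ($q$ odd, $q\equiv0,\pm1\pmod 5$, $\delta\in\mathbb F_q$, $\delta^2+\delta=1$): $\mathrm{ind}=1$, $h=0$; (e) $n=7$, $\mathcal C_3=\langle x,x^{[s]},x^{[3s]}\rangle_{\mathbb F_{q^7}}$ ($q$ odd, $\gcd(s,7)=1$): $\mathrm{ind}=2$, $h=1$; (f) $n=8$, $\mathcal C_4=\langle x,\delta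 x^{[1]}+x^{[5]}\rangle_{\mathbb F_{q^8}}$ ($q$ odd, $\delta^2=-1$): $\mathrm{ind}=1$, $h=0$; (g) $n=8$, $\mathcal C_5=\langle x,x^{[s]},x^{[3s]}\rangle_{\mathbb F_{q^8}}$ ($q\equiv1\pmod3$, $\gcd(s,8)=1$): $\mathrm{ind}=2$, $h=1$; (h) $n=6$, $\mathcal D_1=\langle x^{[1]},x^{[2]},x^{[4]},x-\delta^{[5]}x^{[3]}\rangle_{\mathbb F_{q^6}}$ (with $q,\delta$ as in (c)): $\mathrm{ind}=2$, $h=2$; (i) $n=6$, $\mathcal D_2=\langle x^{[1]},x^{[3]},x-x^{[2]},x^{[4]}-\delta x\rangle_{\mathbb F_{q^6}}$ (with $q,\delta$ as in (d)): $\mathrm{ind}=2$, $h=2$; (j) $n=7$, $\mathcal D_3=\langle x,x^{[2s]},x^{[3s]},x^{[4s]}\rangle_{\mathbb F_{q^7}}$ ($q$ odd, $\gcd(s,7)=1$): $\mathrm{ind}=3$, $h=2$; (k) $n=8$, $\mathcal D_4=\langle x^{[1]},x^{[2]},x^{[3]},x^{[5]},x^{[6]},x-\delta x^{[4]}\rangle_{\mathbb F_{q^8}}$ ($q$ odd, $\delta^2=-1$): $\mathrm{ind}=3$, $h=4$; (l) $n=8$, $\mathcal D_5=\langle x,x^{[2s]},x^{[3s]},x^{[4s]},x^{[5s]}\rangle_{\mathbb F_{q^8}}$ ($q\equiv1\pmod3$, $\gcd(s,8)=1$): $\mathrm{ind}=4$, $h=3$.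
   Context: $q$ is a prime power, $[i]:=q^i$. $\mathcal L_{n,q}$ is the $\mathbb F_{q^n}$-vector space of linearized polynomials $f(x)=\sum_{i=0}^{n-1}a_ix^{[i]}$, $a_i\in\mathbb F_{q^n}$, identified with $\mathbb F_q$-linear maps of $\mathbb F_{q^n}$; rank distance is $\mathrm{rk}(f-g)$ and a code with minimum distance $d$ is MRD if $|\mathcal C|=q^{n(n-d+1)}$. For $f(x)=\sum_i a_ix^{[i]}$, $f(x)^{[j]}:=x^{[j]}\circ f(x)=\sum_i a_i^{[j]}x^{[(i+j)\bmod n]}$, and $\mathcal C^{[j]}=\{f^{[j]}\colon f\in\mathcal C\}$. $h(\mathcal C):=\max\{\dim_{\mathbb F_{q^n}}(\mathcal C\cap\mathcal C^{[j]})\colon 1\le j\le n-1,\ \gcd(j,n)=1\}$. A generalized Gabidulin code is any code equivalent to some $\mathcal G_{l,s}=\langle x,x^{[s]},\ldots,x^{[s(l-1)]}\rangle_{\mathbb F_{q^n}}$ with $\gcd(s,n)=1$, where codes $\mathcal C,\mathcal C'$ are equivalent if there are invertible $h,g\in\mathcal L_{n,q}$ and a field automorphism $\sigma$ (acting on coefficients) with $\{h\circ f^\sigma\circ g\colon f\in\mathcal C\}=\mathcal C'$. The Gabidulin index $\mathrm{ind}(\mathcal C)$ is the maximum dimension of an $\mathbb F_{q^n}$-subspace $\mathcal G\subseteq\mathcal C$ equivalent to a generalized Gabidulin code. $\mathrm N_{q^n/q}(\eta)=\prod_{i=0}^{n-1}\eta^{[i]}$. *)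

(* Defs.v *)
From HB Require Import structures.
From mathcomp Require Import all_boot all_order all_algebra all_field.
Set Implicit Arguments. Unset Strict Implicit. Unset Printing Implicit Defensive.
Import Order.TTheory GRing.Theory.
Local Open Scope ring_scope.

(* Setting: F = F_q (a finite field with q = #|F| elements),
   L = F_{q^n} a finite-dimensional field extension of F, n = \dim_F L.
   A linearized polynomial f = sum_{i<n} a_i x^[i] is represented by its
   coefficient row vector (a_0, ..., a_{n-1}) : 'rV[L]_n.  Codes are
   L-subspaces of 'rV[L]_n. *)

Section LinPoly.
Variables (F : finFieldType) (L : fieldExtType F).

Definition qq : nat := #|F|.
Definition nn : nat := \dim (fullv : {vspace L}).

Notation LP := 'rV[L]_nn.

Definition mon (m : nat) : LP := \row_(i < nn) ((i : nat) == (m %% nn)%N)%:R.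

Definition lpeval (f : LP) (x : L) : L := \sum_(i < nn) f 0 i * x ^+ (qq ^ i)%N.

Definition rk (f : LP) : nat := \dim (limg (linfun (lpeval f) : 'End(L))).

(* composition f o g (reduced mod x^[n] - x) *)
Definition lpcomp (f g : LP) : LP :=
  \sum_(i < nn) \sum_(j < nn) (f 0 i * (g 0 j) ^+ (qq ^ i)%N) *: mon (i + j)%N.

Definition lpinvertible (f : LP) : Prop :=
  exists g : LP, lpcomp f g = mon 0 /\ lpcomp g f = mon 0.

(* f^[j] = x^[j] o f *)
Definition fpow (j : nat) (f : LP) : LP :=
  \sum_(i < nn) (f 0 i ^+ (qq ^ j)%N) *: mon (i + j)%N.

(* C^[j] = { f^[j] : f in C }, as the span of the image of a basis *)
Definition cpow (j : nat) (C : {vspace LP}) : {vspace LP} :=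
  <<[seq fpow j f | f <- vbasis C]>>%VS.

Definition hC (C : {vspace LP}) : nat :=
  \max_(1 <= j < nn | coprime j nn) \dim (C :&: cpow j C)%VS.

Definition fsig (sigma : L -> L) (f : LP) : LP := \row_(i < nn) sigma (f 0 i).

Definition code_equiv (C C' : {vspace LP}) : Prop :=
  exists (h g : LP) (sigma : {rmorphism L -> L}),
    [/\ lpinvertible h, lpinvertible g, bijective sigma &
        forall f' : LP, f' \in C' <->
          exists2 f, f \in C & f' = lpcomp h (lpcomp (fsig sigma f) g)].

Definition gab (l s : nat) : {vspace LP} :=
  <<[seq mon (s * i) | i <- iota 0 l]>>%VS.

Definition is_gen_gabidulin (G : {vspace LP}) : Prop :=
  exists l s, [/\ (0 < l <= nn)%N, coprime s nn & code_equiv G (gab l s)].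

Definition gab_index_is (C : {vspace LP}) (k : nat) : Prop :=
  (exists G : {vspace LP}, [/\ (G <= C)%VS, is_gen_gabidulin G & \dim G = k])
  /\ (forall G : {vspace LP}, (G <= C)%VS -> is_gen_gabidulin G -> (\dim G <= k)%N).

Definition min_dist_is (C : {vspace LP}) (d : nat) : Prop :=
  (exists2 f, f \in C & f != 0 /\ rk f = d) /\
  (forall f, f \in C -> f != 0 -> (d <= rk f)%N).

(* |C| = (q^n)^(dim C) = q^(n(n-d+1)) *)
Definition MRD (C : {vspace LP}) : Prop :=
  exists d, min_dist_is C d /\ ((qq ^ nn) ^ \dim C = qq ^ (nn * (nn - d + 1)))%N.

Definition normN (eta : L) : L := \prod_(i < nn) eta ^+ (qq ^ i)%N.

End LinPoly.

(* Main.v *)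
(* If an L-subspace G of dimension l < n is sent to <x, x^[s], ..., x^[s(l-1)]>
   by f |-> h o f^sigma o g, then h conjugates the scalar maps into the left
   idealizer of the latter code, which consists of scalar maps only; so h is
   semilinear, h = c x^[j], and G = <f, f^[s], ..., f^[s(l-1)]> with f bijective.
   If G is contained in C, then f^[s], ..., f^[s(l-1)] are l - 1 independent
   elements of C and of C^[s], whence ind(C) <= h(C) + 1.  Equality holds for the codes
   (a)-(g), (j), (l), whose h(C) is read off from the linear equations relating
   the coefficients of f and of g when f = g^[j].  For (h), (i), (k) the same
   equations show that f, f^[s], ..., f^[s l] in C forces f = 0 when l is the
   claimed index. *)
Require Import Defs.
From HB Require Import structures.
From mathcomp Require Import all_boot all_order all_algebra all_field.
From mathcomp Require Import all_fingroup all_solvable.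
From mathcomp Require Import zify ring.
Import Order.TTheory GRing.Theory.
Local Open Scope ring_scope.

Set Implicit Arguments.
Unset Strict Implicit.
Unset Printing Implicit Defensive.

(** * Frobenius powers *)

Section Frobenius.
Variables (F : finFieldType) (L : fieldExtType F).
Local Notation q := (qq F).
Local Notation n := (nn L).

(** All arguments work on coefficients indexed modulo n. A code enters through the coefficients that
    vanish on it and the relations among the others, and f = g^[j] reads as a cyclic shift of
    indices with Frobenius applied to the coefficients. An upper bound for h is then a short list of
    positions, one list for each j, whose vanishing forces f = 0. The restriction l < n matters
    because for l = n the Gabidulin code is the whole space and every map lies in its left
    idealizer; \dim C < n guarantees it. When ind = h + 1, a single chain f, f^[s], ..., f^[s(l-1)]
    in C bounds both numbers from below, so that h <= l - 1 is all that remains. In (h), (i), (k)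
    the index is strictly below h + 1, and each index bound needs its own elimination. *)

Lemma qq_gt1 : (1 < q)%N.
Proof. exact: finNzRing_gt1. Qed.

Lemma expq_gt0 i : (0 < q ^ i)%N.
Proof. by rewrite expn_gt0 ltnW ?qq_gt1. Qed.

Lemma nn_gt0 : (0 < n)%N.
Proof. by rewrite /nn adim_gt0. Qed.

Lemma qq_pnat i : [pchar L].-nat (q ^ i)%N.
Proof.
have [p p_pr pcharF] := finPcharP F.
have pcharL : p \in [pchar L] by rewrite pchar_lalg.
rewrite pnatX; apply/orP; left; rewrite (eq_pnat _ (pcharf_eq pcharL)).
by rewrite /qq -cardsT; have /andP[] := fin_ring_pchar_abelem pcharF.
Qed.

Lemma frobD i (x y : L) : (x + y) ^+ (q ^ i) = x ^+ (q ^ i) + y ^+ (q ^ i).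
Proof. exact: exprDn_pchar (qq_pnat i). Qed.

Lemma frob0 i : (0 : L) ^+ (q ^ i) = 0.
Proof. by rewrite expr0n gtn_eqF ?expq_gt0. Qed.

Lemma frob_eq0 i (x : L) : (x ^+ (q ^ i) == 0) = (x == 0).
Proof. by rewrite expf_eq0 expq_gt0. Qed.

Lemma frobN i (x : L) : (- x) ^+ (q ^ i) = - x ^+ (q ^ i).
Proof. by apply/eqP; rewrite -addr_eq0 -frobD addNr frob0. Qed.

Lemma frob_sum i (I : Type) (r : seq I) (P : pred I) (f : I -> L) :
  (\sum_(k <- r | P k) f k) ^+ (q ^ i) = \sum_(k <- r | P k) f k ^+ (q ^ i).
Proof.
by apply: (big_morph (fun x => x ^+ (q ^ i)) (frobD i) (frob0 i)).
Qed.

Lemma frob_comp i j (x : L) : (x ^+ (q ^ i)) ^+ (q ^ j) = x ^+ (q ^ (i + j)).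
Proof. by rewrite -exprM expnD. Qed.

Lemma frob_nn (x : L) : x ^+ (q ^ n) = x.
Proof.
have := memvf x; rewrite /nn /qq.
by rewrite (Fermat's_little_theorem {:L}%AS) => /eqP.
Qed.

Lemma frob_mod i (x : L) : x ^+ (q ^ (i %% n)) = x ^+ (q ^ i).
Proof.
rewrite [in RHS](divn_eq i n); elim: (i %/ n)%N => // k IHk.
by rewrite mulSn -addnA -frob_comp frob_nn.
Qed.

(** The exponents add up to [j * n]. Hence [j * n.-1] is an inverse Frobenius exponent for every
    [j], however large, without subtraction. *)
Lemma frobK j (x : L) : (x ^+ (q ^ (j * n.-1))) ^+ (q ^ j) = x.
Proof.
rewrite frob_comp addnC -mulnS prednK ?nn_gt0 // -frob_mod modnMl.
exact: expr1.
Qed.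

Lemma frob_scalar i (a : F) : (a%:A : L) ^+ (q ^ i) = a%:A.
Proof.
have e1 (b : F) : (b%:A : L) ^+ q = b%:A.
  by rewrite exprZn expr1n /qq expf_card.
by elim: i => [|i IHi]; rewrite ?expr1 // expnSr exprM IHi.
Qed.

Lemma frobZ i (a : F) (x : L) : (a *: x) ^+ (q ^ i) = a *: x ^+ (q ^ i).
Proof. by rewrite -mulr_algl exprMn frob_scalar mulr_algl. Qed.

Lemma card_ext : #|finvect_type L| = (q ^ n)%N.
Proof.
pose fT : finFieldType := finvect_type L.
by have := @card_vspace F fT _ {:finvect_type L}%VS; rewrite card_vspacef.
Qed.

End Frobenius.

(** * Linearized polynomials as maps *)

Section Coefficients.
Variables (F : finFieldType) (L : fieldExtType F).
Local Notation q := (qq F).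
Local Notation n := (nn L).
Local Notation LP := 'rV[L]_n.
Local Notation mon := (mon L).
Implicit Types (f g : LP) (x y : L).

(* Exponents are read modulo n, as x^[n] = x on L. *)
Definition cf (m : nat) (f : LP) : L := \sum_(i < n | i == (m %% n)%N :> nat) f 0 i.

Lemma cf_ord (f : LP) (i : 'I_n) : cf i f = f 0 i.
Proof. by rewrite /cf modn_small // big_pred1_eq. Qed.

Lemma cf_mod m f : cf (m %% n)%N f = cf m f.
Proof. by rewrite /cf modn_mod. Qed.

Lemma cf_eqmod m m' f : m = m' %[mod n] -> cf m f = cf m' f.
Proof. by move=> e; rewrite -cf_mod e cf_mod. Qed.

Lemma cfD m f g : cf m (f + g) = cf m f + cf m g.
Proof. by rewrite /cf -big_split; apply: eq_bigr => i _; rewrite mxE. Qed.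

Lemma cfZ m a f : cf m (a *: f) = a * cf m f.
Proof. by rewrite /cf mulr_sumr; apply: eq_bigr => i _; rewrite mxE. Qed.

Lemma cf_is_scalar m : scalar (cf m).
Proof. by move=> a f g; rewrite cfD cfZ. Qed.

HB.instance Definition _ m := GRing.isLinear.Build L LP L *%R (cf m)
  (cf_is_scalar m).

Lemma cf_mon m a : cf m (mon a) = (a == m %[mod n])%:R.
Proof.
have lt_m : ((m %% n) < n)%N by rewrite ltn_mod nn_gt0.
by rewrite -cf_mod (cf_ord _ (Ordinal lt_m)) mxE eq_sym.
Qed.

Lemma cf_inj f g : (forall m, (m < n)%N -> cf m f = cf m g) -> f = g.
Proof. by move=> e; apply/rowP => i; rewrite -!cf_ord e. Qed.

Lemma cf_eq0 f : (forall m, (m < n)%N -> cf m f = 0) -> f = 0.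
Proof. by move=> e; apply: cf_inj => m lt_m; rewrite e // linear0. Qed.

Lemma mon_mod m : mon (m %% n)%N = mon m.
Proof. by apply: cf_inj => i _; rewrite !cf_mon modn_mod. Qed.

Lemma cf_fpow j m f : cf (m + j) (fpow j f) = cf m f ^+ (q ^ j).
Proof.
have lt_m : ((m %% n) < n)%N by rewrite ltn_mod nn_gt0.
rewrite -[in RHS]cf_mod linear_sum (bigD1 (Ordinal lt_m)) //=.
rewrite cfZ cf_mon modnDml eqxx mulr1 -cf_ord /= big1 ?addr0 // => i ne_i.
rewrite cfZ cf_mon eqn_modDr (modn_small (ltn_ord i)).
case: eqP => [e|]; last by rewrite mulr0.
by case/negP: ne_i; apply/eqP/val_inj.
Qed.

Lemma fpow_mon j m : fpow j (mon m) = mon (m + j).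
Proof.
apply: cf_inj => i _.
(* Adding [j * n.-1] and then [j] does not change the class of [i], which brings the index into the
   form [_ + j] that [cf_fpow] expects. *)
have -> : cf i (fpow j (mon m)) = cf (i + j * n.-1 + j) (fpow j (mon m)).
  apply: cf_eqmod; rewrite -addnA -mulnSr prednK ?nn_gt0 //.
  by rewrite -modnDmr modnMl addn0.
rewrite cf_fpow !cf_mon -(eqn_modDr j).
have -> : (i + j * n.-1 + j = i %[mod n])%N.
  by rewrite -addnA -mulnSr prednK ?nn_gt0 // -modnDmr modnMl addn0.
by case: eqP => _; rewrite ?expr1n ?frob0.
Qed.

Lemma lpeval_cf f x : lpeval f x = \sum_(i < n) cf i f * x ^+ (q ^ i).
Proof. by apply: eq_bigr => i _; rewrite cf_ord. Qed.

Lemma lpevalD f g x : lpeval (f + g) x = lpeval f x + lpeval g x.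
Proof.
by rewrite /lpeval -big_split; apply: eq_bigr => i _; rewrite mxE mulrDl.
Qed.

Lemma lpevalZ a f x : lpeval (a *: f) x = a * lpeval f x.
Proof.
by rewrite /lpeval mulr_sumr; apply: eq_bigr => i _; rewrite mxE mulrA.
Qed.

Lemma lpeval0 x : lpeval (0 : LP) x = 0.
Proof. by rewrite -[0 : LP](scale0r 0) lpevalZ mul0r. Qed.

Lemma lpeval_sum (I : Type) (r : seq I) (P : pred I) (f : I -> LP) x :
  lpeval (\sum_(k <- r | P k) f k) x = \sum_(k <- r | P k) lpeval (f k) x.
Proof.
by apply: (big_morph (fun g : LP => lpeval g x)) => [g h|];
  rewrite ?lpevalD ?lpeval0.
Qed.

Lemma lpeval_mon m x : lpeval (mon m) x = x ^+ (q ^ m).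
Proof.
have lt_m : ((m %% n) < n)%N by rewrite ltn_mod nn_gt0.
rewrite lpeval_cf (bigD1 (Ordinal lt_m)) //= cf_mon modn_mod eqxx mul1r.
rewrite frob_mod big1 ?addr0 // => i ne_i.
rewrite cf_mon (modn_small (ltn_ord i)); case: eqP => [e|]; last by rewrite mul0r.
by case/negP: ne_i; apply/eqP/val_inj.
Qed.

Lemma lpeval_additive f x y : lpeval f (x + y) = lpeval f x + lpeval f y.
Proof.
by rewrite /lpeval -big_split; apply: eq_bigr => i _; rewrite frobD mulrDr.
Qed.

Lemma lpeval_is_linear f : linear (lpeval f : L -> L).
Proof.
move=> a x y; rewrite lpeval_additive; congr (_ + _).
rewrite /lpeval scaler_sumr; apply: eq_bigr => i _.
by rewrite frobZ scalerAr.
Qed.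

HB.instance Definition _ (f : LP) := GRing.isLinear.Build F L L *:%R (lpeval f)
  (lpeval_is_linear f).

(** The ordinary degree is at most q^(N-1), too small for q^N roots. [N] is independent of n: it is
    n for the injectivity of [lpeval] and 5 for a rank bound in degree 6. *)
Lemma lpeval_root_bound (N : nat) (a : nat -> L) (s : seq L) :
    uniq s -> (q ^ N <= size s)%N ->
    {in s, forall x, \sum_(i < N) a i * x ^+ (q ^ i) = 0} ->
  forall i, (i < N)%N -> a i = 0.
Proof.
move=> us le_s a0 i0 lt_i0.
pose p : {poly L} := \sum_(i < N) a i *: 'X^(q ^ i).
have p_eval x : p.[x] = \sum_(i < N) a i * x ^+ (q ^ i).
  by rewrite horner_sum; apply: eq_bigr => i _; rewrite hornerZ hornerXn.
have [p0 | p_neq0] := eqVneq p 0.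
  have : p`_(q ^ i0) = a i0.
    rewrite coef_sum (bigD1 (Ordinal lt_i0)) //= coefZ coefXn eqxx mulr1.
    rewrite big1 ?addr0 // => i ne_i; rewrite coefZ coefXn.
    rewrite eqn_exp2l ?qq_gt1 //; case: eqP => [e|]; last by rewrite mulr0.
    by case/negP: ne_i; apply/eqP/val_inj.
  by rewrite p0 coef0 => <-.
have : (size s < size p)%N.
  apply: max_poly_roots => //; apply/allP => x xs.
  by rewrite rootE p_eval a0.
rewrite ltnNge => /negP []; apply: leq_trans le_s.
case: N => [|N] in a0 lt_i0 p p_eval p_neq0 *.
  by [].
apply: leq_trans (size_sum _ _ _) _; apply/bigmax_leqP => i _.
apply: leq_trans (size_scale_leq _ _) _.
by rewrite size_polyXn ltn_exp2l ?qq_gt1.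
Qed.

Lemma lpeval_inj f g : lpeval f =1 lpeval g -> f = g.
Proof.
move=> e; apply: cf_inj => m lt_m; apply/eqP; rewrite -subr_eq0; apply/eqP.
apply: (@lpeval_root_bound n (fun i => cf i f - cf i g) (enum (finvect_type L))
  (enum_uniq _)) => //.
  by rewrite -(card_ext L) cardE.
move=> x _; transitivity (lpeval f x - lpeval g x); last by rewrite e subrr.
rewrite !lpeval_cf -sumrB.
by apply: eq_bigr => i _; rewrite mulrBl.
Qed.

Lemma lpeval_fpow j f x : lpeval (fpow j f) x = lpeval f x ^+ (q ^ j).
Proof.
rewrite lpeval_sum frob_sum; apply: eq_bigr => i _.
by rewrite lpevalZ lpeval_mon exprMn frob_comp.
Qed.

Lemma lpeval_comp f g x : lpeval (lpcomp f g) x = lpeval f (lpeval g x).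
Proof.
rewrite /lpcomp lpeval_sum; apply: eq_bigr => i _; rewrite lpeval_sum.
rewrite /lpeval frob_sum mulr_sumr; apply: eq_bigr => j _.
by rewrite -/(lpeval _ x) lpevalZ lpeval_mon exprMn frob_comp mulrA addnC.
Qed.

Lemma fpow_mod j f : fpow (j %% n)%N f = fpow j f.
Proof. by apply: lpeval_inj => x; rewrite !lpeval_fpow frob_mod. Qed.

Lemma fpow_comp i j f : fpow i (fpow j f) = fpow (j + i) f.
Proof. by apply: lpeval_inj => x; rewrite !lpeval_fpow frob_comp. Qed.

Lemma fpow0 j : fpow j (0 : LP) = 0.
Proof. by apply: lpeval_inj => x; rewrite lpeval_fpow lpeval0 frob0. Qed.

Lemma fpowD j f g : fpow j (f + g) = fpow j f + fpow j g.
Proof. by apply: lpeval_inj => x; rewrite !(lpeval_fpow, lpevalD) frobD. Qed.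

Lemma fpowZ j a f : fpow j (a *: f) = a ^+ (q ^ j) *: fpow j f.
Proof. by apply: lpeval_inj => x; rewrite !(lpeval_fpow, lpevalZ) exprMn. Qed.

Lemma fpow_sum j (I : Type) (r : seq I) (P : pred I) (f : I -> LP) :
  fpow j (\sum_(k <- r | P k) f k) = \sum_(k <- r | P k) fpow j (f k).
Proof. exact: (big_morph _ (fpowD j) (fpow0 j)). Qed.

End Coefficients.

(** * Gabidulin subcodes *)

Section Codes.
Variables (F : finFieldType) (L : fieldExtType F).
Local Notation q := (qq F).
Local Notation n := (nn L).
Local Notation LP := 'rV[L]_n.
Local Notation mon := (mon L).
Implicit Types (f g : LP) (x y : L) (C D G : {vspace LP}).

Lemma span_vanish (phi : {scalar LP}) (X : seq LP) f :
  {in X, forall v, phi v = 0} -> f \in <<X>>%VS -> phi f = 0.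
Proof.
move=> phi0 /(coord_span (X := in_tuple X)) ->; rewrite linear_sum big1 // => i _.
by rewrite linearZ /= phi0 ?mulr0 // mem_nth.
Qed.

(** [fpow j] is semilinear over a bijective Frobenius power, so the image of a subspace is a
    subspace: coordinates in the image of the basis are pulled back by the inverse Frobenius. *)
Lemma mem_cpow j C f :
  reflect (exists2 g, g \in C & f = fpow j g) (f \in cpow j C).
Proof.
apply: (iffP idP) => [|[g gC ->]].
  rewrite /cpow => /(coord_span (X := in_tuple _)) ->.
  set X := [seq fpow j f | f <- _]; pose c i := coord (in_tuple X) i f ^+ (q ^ (j * n.-1)).
  have sizeX : size X = size (vbasis C) by rewrite size_map.
  exists (\sum_i c i *: (vbasis C)`_i).
    apply: rpred_sum => i _; apply/rpredZ/vbasis_mem/mem_nth.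
    by rewrite -sizeX.
  rewrite fpow_sum; apply: eq_bigr => i _; rewrite fpowZ frobK.
  by rewrite /= (nth_map 0) // -sizeX.
rewrite (coord_vbasis gC) fpow_sum; apply: rpred_sum => i _.
rewrite fpowZ; apply/rpredZ/memv_span/map_f/mem_nth.
by rewrite size_tuple.
Qed.

Lemma dim_ge (l : nat) (vs : nat -> LP) (ps : nat -> nat) C :
    (forall i, (i < l)%N -> vs i \in C) ->
    (forall i j, (i < l)%N -> (j < l)%N -> cf (ps j) (vs i) = (i == j)%:R) ->
  (l <= \dim C)%N.
Proof.
move=> vsC dual; pose X := [tuple vs i | i < l].
have X_i (i : 'I_l) : X`_i = vs i by rewrite -tnth_nth tnth_mktuple.
have freeX : free X.
  apply/freeP => k k0 i; have := congr1 (cf (ps i)) k0.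
  rewrite linear_sum linear0 (bigD1 i) //= linearZ X_i /= dual // eqxx mulr1.
  rewrite big1 ?addr0 // => j ne_ji.
  rewrite linearZ X_i /= dual //.
  by rewrite (_ : (j == i :> nat) = false) ?mulr0 //; apply: negbTE.
have := eqP freeX; rewrite size_tuple => <-; apply: dimvS.
by apply/span_subvP => v /mapP[i _ ->]; apply: vsC.
Qed.

Lemma dim_le (ps : seq nat) C :
    (forall f, f \in C -> {in ps, forall p, cf p f = 0} -> f = 0) ->
  (\dim C <= size ps)%N.
Proof.
move=> inj; pose ev f : 'rV[L]_(size ps) := \row_i cf (nth 0%N ps i) f.
have ev_lin : linear ev.
  by move=> a f g; apply/rowP => i; rewrite !mxE linearP.
pose evL : {linear LP -> 'rV[L]_(size ps)} := HB.pack ev (GRing.isLinear.Build _ _ _ _ ev ev_lin).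
rewrite -(@limg_dim_eq _ _ _ (linfun evL)).
  by apply: leq_trans (dimvS (subvf _)) _; rewrite dimvf /dim /= mul1n.
apply/eqP; rewrite -subv0; apply/subvP => f; rewrite memv_cap memv_ker lfunE /=.
case/andP=> fC /eqP/rowP ev0; rewrite memv0; apply/eqP/inj => // p /(nthP 0%N)[i lt_i <-].
by have := ev0 (Ordinal lt_i); rewrite !mxE.
Qed.

(** * Multiples of s modulo n and Gabidulin codes *)

Lemma eqn_mod_coprime s i j : coprime s n ->
  (s * i == s * j %[mod n]) = (i == j %[mod n]).
Proof.
move=> co_s; wlog le_ij : i j / (i <= j)%N.
  by move=> IH; case/orP: (leq_total i j) => /IH // e; rewrite eq_sym e eq_sym.
rewrite eq_sym [RHS]eq_sym !eqn_mod_dvd ?leq_mul2l ?le_ij ?orbT //.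
by rewrite -mulnBr Gauss_dvdr // coprime_sym.
Qed.

Lemma eq_mod_coprime s i j : coprime s n -> (i < n)%N -> (j < n)%N ->
  (s * i == s * j %[mod n]) = (i == j).
Proof. by move=> co_s lt_i lt_j; rewrite eqn_mod_coprime // !modn_small. Qed.

Lemma coprime_solve s m : coprime s n -> exists2 t, (t < n)%N & m = s * t %[mod n].
Proof.
(* By Euler's theorem [s ^ (totient n).-1] is an inverse of [s] modulo n. *)
move=> co_s; exists ((m * s ^ (totient n).-1) %% n)%N; first by rewrite ltn_mod nn_gt0.
rewrite modnMmr mulnCA -expnS prednK ?totient_gt0 ?nn_gt0 //.
by rewrite -modnMmr (Euler_exp_totient co_s) modnMmr muln1.
Qed.

Lemma gab_cf0 l s m f : f \in gab L l s ->
  (forall i, (i < l)%N -> s * i != m %[mod n]) -> cf m f = 0.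
Proof.
move=> fG ne; apply: (span_vanish (phi := cf m) _ fG) => v /mapP[i].
by rewrite mem_iota => /andP[_ lt_i] ->; rewrite /= cf_mon (negbTE (ne i _)).
Qed.

Lemma mem_mon_gab l s i : (i < l)%N -> mon (s * i) \in gab L l s.
Proof.
by move=> lt_i; apply/memv_span/mapP; exists i; rewrite // mem_iota.
Qed.

Lemma gab_sum l s f : f \in gab L l s ->
  exists a : nat -> L, f = \sum_(i < l) a i *: mon (s * i).
Proof.
pose X := [tuple mon (s * i) | i < l].
have -> : gab L l s = <<X>>%VS by rewrite /gab -val_enum_ord -map_comp.
move/coord_span->; exists (fun i => if insub i is Some k then coord X k f else 0).
by apply: eq_bigr => i _; rewrite valK -tnth_nth tnth_mktuple.
Qed.

Lemma dim_gab_shift s a l D : coprime s n -> (a + l <= n)%N ->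
    (forall i, (i < l)%N -> mon (s * (a + i)) \in D) -> (l <= \dim D)%N.
Proof.
move=> co_s le_n inD; apply: (dim_ge (ps := fun i => (s * (a + i))%N) inD).
move=> i j lt_i lt_j; rewrite cf_mon eq_mod_coprime ?eqn_add2l //; lia.
Qed.

Lemma dim_gab l s : coprime s n -> (l <= n)%N -> \dim (gab L l s) = l.
Proof.
move=> co_s le_n; apply/eqP; rewrite eqn_leq (dim_gab_shift (a := 0) co_s) //.
  by have := dim_span [seq mon (s * i) | i <- iota 0 l]; rewrite size_map size_iota => ->.
by move=> i lt_i; apply: mem_mon_gab.
Qed.

Lemma lpcomp_monr f a j :
  lpcomp f (a *: mon j) = \sum_(i < n) (cf i f * a ^+ (q ^ i)) *: mon (i + j).
Proof.
apply: lpeval_inj => x; rewrite lpeval_comp lpevalZ lpeval_mon lpeval_cf.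
rewrite lpeval_sum; apply: eq_bigr => i _.
by rewrite lpevalZ lpeval_mon exprMn frob_comp mulrA addnC.
Qed.

Lemma cf_lpcomp_monr f a j m :
  cf (m + j) (lpcomp f (a *: mon j)) = cf m f * a ^+ (q ^ m).
Proof.
have lt_m : ((m %% n) < n)%N by rewrite ltn_mod nn_gt0.
rewrite lpcomp_monr linear_sum (bigD1 (Ordinal lt_m)) //= linearZ /= cf_mon.
rewrite modnDml eqxx mulr1 cf_mod frob_mod big1 ?addr0 // => i ne_i.
rewrite linearZ /= cf_mon eqn_modDr (modn_small (ltn_ord i)).
case: eqP => [e|]; last by rewrite mulr0.
by case/negP: ne_i; apply/eqP/val_inj.
Qed.

Lemma lpinvertible_cancel f : lpinvertible f ->
  exists2 g, lpinvertible g & cancel (lpeval f) (lpeval g) /\ cancel (lpeval g) (lpeval f).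
Proof.
case=> g [fg gf]; exists g; first by exists f.
by split=> x; rewrite -lpeval_comp ?fg ?gf lpeval_mon expr1.
Qed.

Lemma cancel_lpinvertible f g :
  cancel (lpeval f) (lpeval g) -> cancel (lpeval g) (lpeval f) -> lpinvertible f.
Proof.
move=> fK gK; exists g.
by split; apply: lpeval_inj => x; rewrite lpeval_comp lpeval_mon expr1.
Qed.

Lemma mon_invertible m : lpinvertible (mon m).
Proof.
apply: (@cancel_lpinvertible _ (mon (m * n.-1))) => x;
  rewrite !lpeval_mon ?frobK //.
by rewrite frob_comp addnC -frob_comp frobK.
Qed.

Definition rcomp g : LP -> LP := fun f => lpcomp f g.

Lemma rcomp_is_linear g : linear (rcomp g).
Proof.
move=> a f1 f2; apply: lpeval_inj => x.
by rewrite !(lpevalD, lpevalZ, lpeval_comp).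
Qed.

HB.instance Definition _ g := GRing.isLinear.Build L LP LP *:%R (rcomp g)
  (rcomp_is_linear g).

Lemma dim_rcomp g D : (forall y, exists x, lpeval g x = y) ->
  \dim (linfun (rcomp g) @: D)%VS = \dim D.
Proof.
move=> g_surj; apply: limg_dim_eq; apply/eqP; rewrite -subv0.
apply/subvP => f; rewrite memv_cap memv_ker lfunE /= => /andP[_ /eqP fg0].
rewrite memv0; apply/eqP/lpeval_inj => y; have [x <-] := g_surj y.
by rewrite -lpeval_comp [lpcomp f g]fg0 !lpeval0.
Qed.

Lemma rcomp_mon j f : rcomp f (mon j) = fpow j f.
Proof. by apply: lpeval_inj => x; rewrite lpeval_comp lpeval_mon lpeval_fpow. Qed.

(** Since x^[j] o f = f^[j], the subcode is the Gabidulin code composed with f on the right, and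
    composing with the inverse of f is the required equivalence. *)
Lemma gab_subcode C s l f : coprime s n -> (0 < l <= n)%N -> lpinvertible f ->
    (forall i, (i < l)%N -> fpow (s * i) f \in C) ->
  exists G, [/\ (G <= C)%VS, is_gen_gabidulin G & \dim G = l].
Proof.
move=> co_s /andP[l_gt0 le_l] inv_f inC.
have [g inv_g [fK gK]] := lpinvertible_cancel inv_f.
exists (linfun (rcomp f) @: gab L l s)%VS; split.
- rewrite limg_span; apply/span_subvP => v /mapP[u /mapP[i]].
  by rewrite mem_iota => /andP[_ lt_i] -> ->; rewrite lfunE /= rcomp_mon inC.
- exists l, s; rewrite l_gt0; split=> //.
  exists (mon 0), g, idfun; split=> //; first exact: mon_invertible.
    by exists idfun.
  have ev u x : lpeval (lpcomp (mon 0) (lpcomp (fsig idfun u) g)) x = lpeval u (lpeval g x).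
    rewrite !lpeval_comp lpeval_mon expr1; congr (lpeval _ _).
    by apply/rowP => i; rewrite mxE.
  move=> u; split=> [uG | [v /memv_imgP[w wG ->] ->]].
    exists (rcomp f u); first by rewrite -[rcomp f u]lfunE memv_img.
    by apply: lpeval_inj => x; rewrite ev lpeval_comp gK.
  rewrite (_ : lpcomp _ _ = w) //; apply: lpeval_inj => x.
  by rewrite ev lfunE /= lpeval_comp gK.
- rewrite dim_rcomp ?dim_gab // => y.
  by exists (lpeval g y).
Qed.

(** * Lower and upper bounds for h *)

Lemma hC_ge_dim C j d : (0 < j < n)%N -> coprime j n ->
  (d <= \dim (C :&: cpow j C))%N -> (d <= hC C)%N.
Proof.
move=> lt_j co_j le_d; apply: leq_trans le_d _.
apply: (@leq_bigmax_seq _ (index_iota 1 n) (fun j => coprime j n)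
  (fun j => \dim (C :&: cpow j C)%VS)) => //.
by rewrite mem_index_iota.
Qed.

Lemma hC_ge C s l f : (1 < n)%N -> coprime s n -> (l <= n)%N ->
    (forall y, exists x, lpeval f x = y) ->
    (forall i, (i < l)%N -> fpow (s * i) f \in C) ->
  (l.-1 <= hC C)%N.
Proof.
move=> n_gt1 co_s le_l f_surj inC.
(* [hC] only ranges over exponents from 1 to n - 1, so [s] is replaced by its residue, which is
   nonzero because n > 1. *)
have co_j : coprime (s %% n) n by rewrite coprime_modl.
have j_gt0 : (0 < s %% n)%N.
  rewrite lt0n; apply: contraTneq co_j => ->.
  by rewrite /coprime gcd0n gtn_eqF.
apply: (hC_ge_dim (j := s %% n)) => //.
  by rewrite j_gt0 ltn_mod ltnW.
(* Independence is clear for the monomials and survives right composition with the surjective f. *)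
pose D := <<[seq mon (s * (1 + i)) | i <- iota 0 l.-1]>>%VS.
have le_D : (l.-1 <= \dim D)%N.
  apply: (dim_gab_shift (a := 1) co_s) => [|i lt_i]; first lia.
  by apply/memv_span/mapP; exists i; rewrite // mem_iota.
apply: leq_trans le_D _; rewrite -(dim_rcomp D f_surj); apply: dimvS.
rewrite /D limg_span; apply/span_subvP => v /mapP[u /mapP[i]].
rewrite mem_iota => /andP[_ lt_i] -> ->; rewrite lfunE /= rcomp_mon memv_cap.
rewrite inC /=; last lia.
apply/mem_cpow; exists (fpow (s * i) f); first by apply: inC; lia.
by rewrite fpow_mod fpow_comp mulnDr muln1 addnC.
Qed.

(** An element of the intersection is f = g^[j] with f and g both in C, so the equations of C may be
    used twice. The congruence leaves the representatives of both indices free. *)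
Lemma hC_le C d :
    (forall j, (0 < j < n)%N -> coprime j n -> exists2 ps : seq nat,
       (size ps <= d)%N &
       forall f g, f \in C -> g \in C ->
         (forall m k, k = m + j %[mod n] -> cf k f = cf m g ^+ (q ^ j)) ->
         {in ps, forall p, cf p f = 0} -> f = 0) ->
  (hC C <= d)%N.
Proof.
move=> pos; apply/bigmax_leqP_seq => j; rewrite mem_index_iota => lt_j co_j.
have [ps le_ps inj] := pos j lt_j co_j; apply: leq_trans le_ps.
apply: dim_le => f; rewrite memv_cap => /andP[fC /mem_cpow[g gC e]] f0.
by apply: (inj f g) => // m k /cf_eqmod ->; rewrite e cf_fpow.
Qed.


(** * Structure of the subcodes equivalent to Gabidulin codes *)

Lemma lpeval_fsig (sigma : {rmorphism L -> L}) f x :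
  lpeval (fsig sigma f) (sigma x) = sigma (lpeval f x).
Proof.
by rewrite /lpeval rmorph_sum; apply: eq_bigr => i _; rewrite mxE rmorphM rmorphXn.
Qed.

(** Comparing the coefficients of x^[j] in h(a x) = b h(x) gives h_j a^[j] = b h_j, which determines
    b. As j does not depend on a, taking x = 1 shows that h has a single term. *)
Lemma lpcomp_homogeneous h (h' : LP) a :
    cancel (lpeval h) (lpeval h') -> cancel (lpeval h') (lpeval h) ->
    (exists b, forall x, lpeval h (a * x) = b * lpeval h x) ->
  forall j, cf j h != 0 -> forall x, lpeval h (a * x) = a ^+ (q ^ j) * lpeval h x.
Proof.
move=> hK h'K [b hb] j hj x; rewrite hb; congr (_ * _).
have e : lpcomp h (a *: mon 0) = b *: h.
  by apply: lpeval_inj => y; rewrite lpeval_comp !lpevalZ lpeval_mon expr1 hb.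
have := congr1 (cf (j + 0)) e; rewrite cf_lpcomp_monr addn0 linearZ /= mulrC.
by move/(mulIf hj).
Qed.

(** A nonzero coefficient of p at s t with 0 < t < n would move some x^[s i] out of the code: i = l
    - t when t < l, which lands on s l, and i = 0 otherwise. The first choice is where l < n
    enters. *)
Lemma gab_idealizer l s p : coprime s n -> (0 < l < n)%N ->
  (forall i, (i < l)%N -> lpcomp p (mon (s * i)) \in gab L l s) -> p = cf 0 p *: mon 0.
Proof.
move=> co_s /andP[l_gt0 lt_l] stab; apply: cf_inj => m lt_m.
rewrite linearZ /= cf_mon mod0n modn_small //.
case: eqP => [<-|/eqP m_neq0]; first by rewrite mulr1.
rewrite mulr0; have [t lt_t e] := coprime_solve m co_s.
have shift i : (i < l)%N -> (forall k, (k < l)%N -> s * k != s * (t + i) %[mod n]) -> cf m p = 0.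
  move=> lt_i ne; have := stab i lt_i; rewrite -[mon (s * i)]scale1r => pG.
  have := cf_lpcomp_monr p 1 (s * i) m; rewrite expr1n mulr1 => <-.
  apply: (gab_cf0 pG) => k lt_k; rewrite -modnDml e modnDml -mulnDr; exact: ne.
have [lt_tl|le_lt] := ltnP t l.
  have t_gt0 : (0 < t)%N.
    case: t e {lt_t shift lt_tl} => // /eqP.
    rewrite muln0 mod0n modn_small // eq_sym in m_neq0 *.
    by rewrite (negbTE m_neq0).
  apply: (shift (l - t)%N) => [|k lt_k]; first lia.
  by rewrite eq_mod_coprime //; lia.
by apply: (shift 0%N) => // k lt_k; rewrite addn0 eq_mod_coprime //; lia.
Qed.

Lemma gen_gabidulin_struct G : is_gen_gabidulin G -> (\dim G < n)%N ->
  exists s f, [/\ coprime s n, forall y, exists x, lpeval f x = y &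
    forall i, (i < \dim G)%N -> fpow (s * i) f \in G].
Proof.
case=> l [s [/andP[l_gt0 le_l] co_s [h [g [sigma [inv_h inv_g [tau sK tK] E]]]]]] ltG.
have [h' _ [hK h'K]] := lpinvertible_cancel inv_h.
have [g' _ [gK g'K]] := lpinvertible_cancel inv_g.
pose Phi f := lpcomp h (lpcomp (fsig sigma f) g).
have PhiE f x : lpeval (Phi f) x = lpeval h (sigma (lpeval f (tau (lpeval g x)))).
  by rewrite !lpeval_comp -{1}[lpeval g x]tK lpeval_fsig.
have tau_surj y : exists x, tau (lpeval g x) = y.
  by exists (lpeval g' (sigma y)); rewrite g'K sK.
have Phi_inj : injective Phi.
  move=> f1 f2 e; apply: lpeval_inj => y; have [x <-] := tau_surj y.
  apply: (can_inj sK); apply: (can_inj hK).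
  by rewrite -!PhiE e.
have PhiG f : Phi f \in gab L l s -> f \in G.
  by case/E=> f1 f1G /Phi_inj ->.
(* For l = n the map [Phi] would pull the whole space back into G, against \dim G < n. *)
have {l_gt0 le_l} lt_l : (0 < l < n)%N.
  rewrite l_gt0 ltn_neqAle le_l andbT; apply: contraTneq ltG => l_n.
  suff -> : G = fullv by rewrite dimvf /dim /= mul1n ltnn.
  apply/vspaceP => f; rewrite memvf; apply: PhiG.
  suff -> : gab L l s = fullv by rewrite memvf.
  apply/eqP; rewrite -dimv_leqif_eq ?subvf // dim_gab //.
  by rewrite dimvf /dim /= mul1n l_n.
(* Multiplying f by [tau a] in G corresponds, after [Phi], to applying h o (a x) o h^-1. This
   conjugate therefore stabilizes the Gabidulin code and is a scalar map. *)
have homog a : exists b, forall x, lpeval h (a * x) = b * lpeval h x.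
  pose p := lpcomp h (lpcomp (a *: mon 0) h').
  have pE x : lpeval p x = lpeval h (a * lpeval h' x).
    by rewrite !lpeval_comp lpevalZ lpeval_mon expr1.
  exists (cf 0 p) => x.
  have := pE (lpeval h x); rewrite hK => <-.
  rewrite {1}(_ : p = cf 0 p *: mon 0) ?lpevalZ ?lpeval_mon ?expr1 //.
  apply: (gab_idealizer co_s lt_l) => i lt_i.
  have /E [f fG fE] : mon (s * i) \in gab L l s by apply: mem_mon_gab.
  apply/E; exists (tau a *: f); first exact: rpredZ.
  apply: lpeval_inj => x1; rewrite -/(Phi _) PhiE lpeval_comp fE -/(Phi _) pE PhiE hK.
  by rewrite lpevalZ rmorphM tK.
have /existsP[j hj] : [exists j : 'I_n, cf j h != 0].
  apply: contraT; rewrite negb_exists => /forallP h0.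
  have h_0 : h = 0.
    apply: cf_eq0 => m lt_m; have := h0 (Ordinal lt_m).
    by rewrite negbK => /eqP.
  by have := hK 1; rewrite h_0 lpeval0 linear0 => /eqP; rewrite eq_sym oner_eq0.
pose c := lpeval h 1.
have hE a : lpeval h a = c * a ^+ (q ^ j).
  by rewrite -[a in LHS]mulr1 (lpcomp_homogeneous hK h'K (homog a) hj) mulrC.
have c_neq0 : c != 0.
  apply/eqP => c0; have := hK 1; rewrite -/c c0 linear0 => /eqP.
  by rewrite eq_sym oner_eq0.
have frob_inj : injective (fun x : L => x ^+ (q ^ j)).
  move=> x y /= e; apply/eqP; rewrite -subr_eq0 -(frob_eq0 j) frobD frobN.
  by rewrite e subrr.
(* The preimage of c x^[s i] is taken, so that the factor c of h = c x^[j] cancels. *)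
have pre i : (i < l)%N -> exists2 f, f \in G &
    forall x, sigma (lpeval f (tau (lpeval g x))) ^+ (q ^ j) = x ^+ (q ^ (s * i)).
  move=> lt_i; have /E[f fG fE] : c *: mon (s * i) \in gab L l s.
    by apply/rpredZ/mem_mon_gab.
  exists f => // x; apply: (mulfI c_neq0).
  by rewrite -hE -PhiE /Phi -fE lpevalZ lpeval_mon.
have [f fG fE] : exists2 f, f \in G &
    forall x, sigma (lpeval f (tau (lpeval g x))) ^+ (q ^ j) = x.
  have [//|f fG fE] := pre 0%N; first by case/andP: lt_l.
  by exists f => // x; rewrite fE muln0 expr1.
(* The automorphism sigma commutes with powers, so raising the identity for f to the power q^(s i)
   identifies f^[s i] with the preimage found above. *)
have powG i : (i < l)%N -> fpow (s * i) f \in G.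
  case/pre=> f1 f1G f1E; rewrite (_ : fpow _ _ = f1) //.
  apply: lpeval_inj => y; have [x <-] := tau_surj y.
  apply: (can_inj sK); apply: frob_inj; rewrite f1E lpeval_fpow rmorphXn.
  by rewrite -exprM mulnC exprM fE.
exists s, f; split=> // [y|k lt_k].
  exists (tau (lpeval g (sigma y ^+ (q ^ j)))).
  by apply: (can_inj sK); apply: frob_inj; rewrite fE.
apply: powG; apply: leq_trans lt_k _.
(* It remains to see that \dim G <= l, that is, that the f^[s i] with i < l span G. *)
apply: leq_trans (_ : (size [seq fpow (s * i) f | i <- iota 0 l] <= l)%N);
  last by rewrite size_map size_iota.
apply: leq_trans (dim_span _); apply: dimvS; apply/subvP => f1 f1G.
have /gab_sum[a aE] : Phi f1 \in gab L l s by apply/E; exists f1.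
(* The coefficients of [Phi f1] are carried back through h and sigma: divide by c, take the q^j-th
   root, apply [tau]. *)
pose b i := tau ((a i / c) ^+ (q ^ (j * n.-1))).
have -> : f1 = \sum_(i < l) b i *: fpow (s * i) f.
  apply: Phi_inj; apply: lpeval_inj => x.
  rewrite aE PhiE hE !lpeval_sum rmorph_sum frob_sum mulr_sumr.
  apply: eq_bigr => i _; rewrite !lpevalZ lpeval_mon lpeval_fpow rmorphM tK.
  rewrite rmorphXn exprMn frobK mulrA (mulrC c) divfK //; congr (_ * _).
  by rewrite -[RHS]exprM (mulnC (q ^ (s * i))%N) exprM fE.
apply: rpred_sum => i _; apply/rpredZ/memv_span/mapP.
by exists (i : nat); rewrite ?mem_iota /=.
Qed.

Lemma gen_gabidulin_dim_le G C : (1 < n)%N -> (\dim C < n)%N ->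
  (G <= C)%VS -> is_gen_gabidulin G -> (\dim G <= (hC C).+1)%N.
Proof.
move=> n_gt1 ltC GC gabG; have ltG := leq_ltn_trans (dimvS GC) ltC.
have [s [f [co_s f_surj inG]]] := gen_gabidulin_struct gabG ltG.
rewrite -(leq_add2r 1) in ltG *.
have := hC_ge (C := C) n_gt1 co_s (l := \dim G) _ f_surj.
case: (\dim G) ltG inG => // d ltG inG; apply; first lia.
by move=> i lt_i; apply: (subvP GC); apply: inG.
Qed.

(** The chain gives ind >= l and h >= l - 1; with ind <= h + 1, the assumed bound on h makes both
    equalities. *)
Lemma gab_index_hC_succ C s l f : (1 < n)%N -> (\dim C < n)%N -> coprime s n ->
    (0 < l)%N -> lpinvertible f ->
    (forall i, (i < l)%N -> fpow (s * i) f \in C) -> (hC C <= l.-1)%N ->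
  gab_index_is C l /\ hC C = l.-1.
Proof.
move=> n_gt1 ltC co_s l_gt0 inv_f inC le_h.
have [g _ [fK gK]] := lpinvertible_cancel inv_f.
have f_surj y : exists x, lpeval f x = y by exists (lpeval g y).
(* A longer chain would already contain n independent elements of C. *)
have le_l : (l <= n)%N.
  rewrite leqNgt; apply/negP => lt_l.
  have := hC_ge (C := C) n_gt1 co_s (leqnn n) f_surj.
  have : (n <= \dim C)%N.
    rewrite -{1}(dim_gab co_s (leqnn n)) -(dim_rcomp (gab L n s) f_surj).
    apply: dimvS; rewrite limg_span; apply/span_subvP => v /mapP[u /mapP[i]].
    rewrite mem_iota => /andP[_ lt_i] -> ->; rewrite lfunE /= rcomp_mon.
    by apply: inC; lia.
  by rewrite leqNgt ltC.
split; last by apply/eqP; rewrite eqn_leq le_h (hC_ge n_gt1 co_s le_l f_surj).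
split; first by apply: (gab_subcode co_s _ inv_f inC); rewrite l_gt0.
move=> G GC gabG; apply: leq_trans (gen_gabidulin_dim_le n_gt1 ltC GC gabG) _.
by rewrite -ltnS prednK in le_h *.
Qed.

End Codes.

(** * Monomial and twisted codes *)

Section Families.
Variables (F : finFieldType) (L : fieldExtType F).
Local Notation q := (qq F).
Local Notation n := (nn L).
Local Notation LP := 'rV[L]_n.
Local Notation mon := (mon L).
Implicit Types (f g : LP) (x y : L) (C D G : {vspace LP}).

Lemma span_cf_eq c m k (X : seq LP) f :
  {in X, forall v, cf m v = c * cf k v} -> f \in <<X>>%VS -> cf m f = c * cf k f.
Proof.
move=> cX /(coord_span (X := in_tuple X)) ->.
rewrite !linear_sum mulr_sumr; apply: eq_bigr => i _.
by rewrite !linearZ /= cX ?mem_nth // mulrCA.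
Qed.

Definition residues (S : seq nat) := [seq (m %% n)%N | m <- S].

Lemma mon_code_cf0 S m f : f \in <<map mon S>>%VS ->
  (m %% n)%N \notin residues S -> cf m f = 0.
Proof.
move=> fS mS; apply: (span_vanish (phi := cf m) _ fS) => v /mapP[i iS ->] /=.
by rewrite cf_mon; case: eqP => // e; case/mapP: mS; exists i.
Qed.

Lemma mem_mon_code S m : (m %% n)%N \in residues S -> mon m \in <<map mon S>>%VS.
Proof. by case/mapP=> k kS e; rewrite -mon_mod e mon_mod memv_span ?map_f. Qed.

(** Two monomial codes meet in the span of their common monomials; the filtered list collects the
    residues r such that both r and r - j occur, with [r + (n - j)] standing for r - j. The chain
    starts at x^[e]. *)
Lemma mon_code_index S s l e : (1 < n)%N -> (size S < n)%N -> coprime s n -> (0 < l)%N ->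
    (forall i, (i < l)%N -> ((e + s * i) %% n)%N \in residues S) ->
    (forall j, (0 < j < n)%N -> coprime j n ->
       (size [seq r <- iota 0 n | (r \in residues S) &&
          (((r + (n - j)) %% n)%N \in residues S)] <= l.-1)%N) ->
  gab_index_is <<map mon S>> l /\ hC <<map mon S>> = l.-1.
Proof.
move=> n_gt1 ltS co_s l_gt0 inS cap.
apply: (gab_index_hC_succ n_gt1 _ co_s l_gt0 (mon_invertible L e)).
- by apply: leq_ltn_trans (dim_span _) _; rewrite size_map.
- by move=> i lt_i; rewrite fpow_mon mem_mon_code ?inS.
apply: hC_le => j /andP[j_gt0 lt_j] co_j.
exists [seq r <- iota 0 n | (r \in residues S) && (((r + (n - j)) %% n)%N \in residues S)].
  by apply: cap; rewrite ?j_gt0.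
move=> f g fS gS fg f0; apply: cf_eq0 => m lt_m.
have [mS|mS] := boolP (m \in residues S); last first.
  by apply: mon_code_cf0 fS _; rewrite modn_small.
have [mjS|mjS] := boolP (((m + (n - j)) %% n)%N \in residues S).
  by apply: f0; rewrite mem_filter mS mjS mem_iota.
rewrite (fg (m + (n - j))%N) ?(mon_code_cf0 gS) ?frob0 //.
by rewrite -addnA subnK ?modnDr // ltnW.
Qed.

Lemma gabidulin_index k s : coprime s n -> (1 <= k < n)%N ->
  gab_index_is (gab L k s) k /\ hC (gab L k s) = k.-1.
Proof.
move=> co_s /andP[k_gt0 lt_k].
have n_gt1 : (1 < n)%N by lia.
apply: (gab_index_hC_succ n_gt1 _ co_s k_gt0 (mon_invertible L 0)).
- by rewrite dim_gab // ltnW.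
- by move=> i lt_i; rewrite fpow_mon mem_mon_gab.
apply: hC_le => j /andP[j_gt0 lt_j] co_j.
have [m lt_m jE] := coprime_solve j co_s.
have m_gt0 : (0 < m)%N.
  rewrite lt0n; apply/eqP => m0; move: jE.
  by rewrite m0 muln0 mod0n modn_small // => j0; rewrite j0 in j_gt0.
(* With j = s m, this choice gives p < k <= p + n - m < n: the coefficient of f at s p comes from
   one of g outside its support. *)
pose p := minn m.-1 k.-1; have lt_p : (p < k)%N by rewrite /p; lia.
exists [seq (s * i)%N | i <- rem p (iota 0 k)].
  by rewrite size_map size_rem ?size_iota // mem_iota.
move=> f g fG gG fg f0.
have fi i : (i < k)%N -> cf (s * i) f = 0.
  move=> lt_i; have [->|ne_ip] := eqVneq i p; last first.
    by apply/f0/map_f; rewrite mem_rem_uniq ?iota_uniq // inE ne_ip mem_iota.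
  rewrite (fg (s * (p + n - m))%N).
    rewrite (gab_cf0 gG) ?frob0 // => i' lt_i'.
    have [le_mp|lt_pm] := leqP m p; first by move: le_mp; rewrite /p; lia.
    by rewrite eq_mod_coprime //; rewrite /p in lt_pm *; lia.
  rewrite -modnDmr jE modnDmr -mulnDr subnK ?mulnDr ?modnMDr //; last lia.
  by rewrite addnC modnMDl.
apply: cf_eq0 => r lt_r; have [t lt_t rE] := coprime_solve r co_s.
rewrite (cf_eqmod f rE); have [/fi //|le_kt] := ltnP t k.
by apply: (gab_cf0 fG) => i lt_i; rewrite eq_mod_coprime //; lia.
Qed.

(* Here A i stands for the coefficient of x^[s i] of an element of
   H_{k,s}(eta) and of H_{k,s}(eta)^[s m]; the positions p and p' bound the
   dimension of that intersection by k - 2. *)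
Lemma twisted_positions k m : coprime m n -> (0 < m < n)%N -> (1 < k < n - 1)%N ->
  exists p p', [/\ (p < k)%N, (p' < k)%N, p != p' &
    forall (A : nat -> L) eta eta', eta != 0 -> eta' != 0 ->
      (forall i, A (i + n)%N = A i) ->
      (forall i, (k < i < n)%N -> A i = 0) ->
      (forall i, (k < i < n)%N -> A (i + m)%N = 0) ->
      A k = eta * A 0%N -> A (k + m)%N = eta' * A m ->
      (forall i, (i < k)%N -> i != p -> i != p' -> A i = 0) ->
    A p = 0 /\ A p' = 0].
Proof.
move=> co_m /andP[m_gt0 lt_m] /andP[k_gt1 lt_k].
(* The zeros of the translate, seen modulo n, fill the window k + m - n < i < m. *)
have shifted (A : nat -> L) : (forall i, A (i + n)%N = A i) ->
    (forall i, (k < i < n)%N -> A (i + m)%N = 0) ->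
    forall i, (k + m < i + n)%N -> (i < m)%N -> A i = 0.
  move=> per Am i lt1 lt2; rewrite -per.
  by rewrite (_ : i + n = i + n - m + m)%N ?Am //; lia.
(* Here the window meets the indices only in 0, and the second zero comes from the twisted relation
   of the translate. *)
have [m1|m_neq1] := eqVneq m 1%N.
  exists 0%N, 1%N; split=> // [|A eta eta' eta0 eta'0 per A0 Am Ak Akm _]; first lia.
  split; first by apply: (shifted A per Am); lia.
  move: Akm; rewrite m1 A0; last lia.
  by move/esym/eqP; rewrite mulf_eq0 (negbTE eta'0) => /eqP.
have top (A : nat -> L) eta : eta != 0 -> A k = eta * A 0%N -> A k = 0 -> A 0%N = 0.
  by move=> eta0 -> /eqP; rewrite mulf_eq0 (negbTE eta0) => /eqP.
have [mn|m_neqn] := eqVneq m n.-1.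
  exists 0%N, k.-1; split=> [||| A eta eta' eta0 eta'0 per A0 Am Ak Akm _]; try lia.
  split; first by apply: (top A eta) => //; apply: (shifted A per Am); lia.
  rewrite -per (_ : k.-1 + n = k + m)%N; last lia.
  by rewrite Akm mn A0 ?mulr0 //; lia.
have [kn|k_neqn] := eqVneq k (n - 2)%N.
  (* In this case m = k and m - 2 = 0, and the two relations would only express A 0 through itself;
     coprimality rules it out. *)
  have m_ne2 : (m == 2) && (n == 4) = false.
    by apply: contraTF co_m => /andP[/eqP-> /eqP->].
  exists m.-1, m.-2; split=> [||| A eta eta' eta0 eta'0 per A0 Am Ak Akm rest]; try lia.
  split; first by apply: (shifted A per Am); lia.
  rewrite -per (_ : m.-2 + n = k + m)%N; last lia.
  rewrite Akm; have [lt_mk|le_km] := ltnP m k.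
    by rewrite rest ?mulr0 //; lia.
  have -> : m = k by lia.
  by rewrite Ak rest ?mulr0 //; lia.
(* Now k <= n - 3, so the window has at least two indices. The remaining cases locate two usable
   ones, where the index k counts for 0 by [top]. *)
have [le_mk|lt_km] := leqP m k.
  exists m.-1, m.-2; split=> [||| A eta eta' eta0 eta'0 per A0 Am Ak Akm _]; try lia.
  by split; apply: (shifted A per Am); lia.
have [mk|m_neqk] := eqVneq m k.+1.
  exists 0%N, k.-1; split=> [||| A eta eta' eta0 eta'0 per A0 Am Ak Akm _]; try lia.
  split; last by apply: (shifted A per Am); lia.
  by apply: (top A eta) => //; apply: (shifted A per Am); lia.
have [lt_n|le_n] := ltnP (k.+1 + m)%N n.
  exists 0%N, 1%N; split=> // [|A eta eta' eta0 eta'0 per A0 Am Ak Akm _]; first lia.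
  by split; apply: (shifted A per Am); lia.
have [mn2|m_neqn2] := eqVneq m (n - 2)%N.
  exists 0%N, k.-1; split=> [||| A eta eta' eta0 eta'0 per A0 Am Ak Akm _]; try lia.
  split; last by apply: (shifted A per Am); lia.
  by apply: (top A eta) => //; apply: (shifted A per Am); lia.
exists (k.+1 + m - n)%N, (k.+2 + m - n)%N.
split=> [||| A eta eta' eta0 eta'0 per A0 Am Ak Akm _]; try lia.
by split; apply: (shifted A per Am); lia.
Qed.

(** * Twisted Gabidulin codes *)

Definition twisted_gab (k s : nat) (eta : L) : {vspace LP} :=
  span ((mon 0 + eta *: mon (s * k)) :: [seq mon (s * i) | i <- iota 1 (k - 1)]).

Lemma eq0_mod_coprime s i : coprime s n -> (i < n)%N ->
  (0 == s * i %[mod n]) = (0 == i)%N.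
Proof.
by move=> co_s lt_i; have := eq_mod_coprime co_s (nn_gt0 L) lt_i; rewrite muln0.
Qed.

Lemma twisted_gab_vanish k s eta i f : coprime s n -> (k < i < n)%N ->
  f \in twisted_gab k s eta -> cf (s * i) f = 0.
Proof.
move=> co_s lt_i; apply: (span_vanish (phi := cf (s * i))) => v /=.
rewrite inE => /predU1P[->|/mapP[i']].
  rewrite linearD linearZ /= !cf_mon (eq0_mod_coprime co_s) ?(eq_mod_coprime co_s); try lia.
  have [-> ->] : (0 == i)%N = false /\ (k == i) = false by lia.
  by rewrite !mulr0n mulr0 addr0.
rewrite mem_iota => lt_i' ->; rewrite cf_mon (eq_mod_coprime co_s); try lia.
by have -> : (i' == i) = false by lia.
Qed.

Lemma twisted_gab_rel k s eta f : coprime s n -> (1 < k < n)%N ->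
  f \in twisted_gab k s eta -> cf (s * k) f = eta * cf (s * 0) f.
Proof.
move=> co_s lt_k; apply: span_cf_eq => v; rewrite inE => /predU1P[->|/mapP[i]].
  rewrite muln0 !linearD !linearZ /= !cf_mon !eqxx (eq_sym (s * k %% n)%N).
  rewrite !(eq0_mod_coprime co_s); last lia.
  have -> : (0 == k)%N = false by lia.
  by rewrite mulr0n mulr1n mulr0 add0r addr0.
rewrite mem_iota => lt_i ->; rewrite muln0 !cf_mon (eq_mod_coprime co_s); try lia.
rewrite (eq_sym (s * i %% n)%N) (eq0_mod_coprime co_s); last lia.
have [-> ->] : (0 == i)%N = false /\ (i == k) = false by lia.
by rewrite !mulr0n mulr0.
Qed.

Lemma twisted_gab_index k s eta : coprime s n -> (1 < k < n - 1)%N -> eta != 0 ->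
  gab_index_is (twisted_gab k s eta) k.-1 /\ hC (twisted_gab k s eta) = k.-1.-1.
Proof.
move=> co_s bk eta0; have n_gt1 : (1 < n)%N by lia.
(* The chain consists of the untwisted generators x^[s], ..., x^[s(k-1)]. *)
apply: (gab_index_hC_succ n_gt1 _ co_s _ (mon_invertible L s)).
- apply: leq_ltn_trans (dim_span _) _; rewrite /= size_map size_iota; lia.
- lia.
- move=> i lt_i; rewrite fpow_mon -[X in (X + _)%N]muln1 -mulnDr.
  apply/memv_span; rewrite inE; apply/orP; right; apply/mapP.
  by exists (1 + i)%N; rewrite // mem_iota; lia.
apply: hC_le => j /andP[j_gt0 lt_j] co_j.
have [m lt_m jE] := coprime_solve j co_s.
have m_gt0 : (0 < m)%N.
  rewrite lt0n; apply/eqP => m0; move: jE.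
  by rewrite m0 muln0 mod0n modn_small // => j0; rewrite j0 in j_gt0.
have co_m : coprime m n.
  by move: co_j; rewrite -coprime_modl jE coprime_modl coprimeMl => /andP[].
have [|p [p' [lt_p lt_p' ne_p zero]]] := twisted_positions co_m _ bk.
  by rewrite m_gt0.
exists [seq (s * i)%N | i <- rem p' (rem p (iota 0 k))].
  rewrite size_map !size_rem ?mem_rem_uniq ?iota_uniq // ?size_iota //.
    by rewrite mem_iota.
  by rewrite inE mem_iota eq_sym ne_p.
move=> f g fH gH fg f0.
have lt_kn : (1 < k < n)%N by lia.
have shift i : cf (s * (i + m)) f = cf (s * i) g ^+ (q ^ j).
  by apply: fg; rewrite mulnDr -modnDmr -jE modnDmr.
have rest i : (i < k)%N -> i != p -> i != p' -> cf (s * i) f = 0.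
  move=> lt_i ne1 ne2; apply/f0/map_f.
  by rewrite mem_rem_uniq ?rem_uniq ?iota_uniq //
    inE ne2 mem_rem_uniq ?iota_uniq // inE ne1 mem_iota.
(* The relation of the translated code carries the conjugate of eta. *)
have [||||||||fp fp'] := zero (fun i => cf (s * i) f) eta (eta ^+ (q ^ j)) => //.
- by rewrite frob_eq0.
- by move=> i; apply: cf_eqmod; rewrite mulnDr addnC modnMDl.
- by move=> i lt_i; apply: twisted_gab_vanish fH.
- by move=> i lt_i; rewrite shift (twisted_gab_vanish co_s lt_i gH) frob0.
- exact: twisted_gab_rel fH.
- by rewrite shift (twisted_gab_rel co_s lt_kn gH) exprMn -shift.
apply: cf_eq0 => r lt_r; have [t lt_t rE] := coprime_solve r co_s.
rewrite (cf_eqmod f rE).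
have fi i : (i < k)%N -> cf (s * i) f = 0.
  by move=> lt_i; have [->//|ne1] := eqVneq i p; have [->//|ne2] := eqVneq i p'; apply: rest.
have [/fi //|le_kt] := ltnP t k; have [->|ne_tk] := eqVneq t k.
  by rewrite (twisted_gab_rel co_s lt_kn fH) fi ?mulr0 //; lia.
by apply: twisted_gab_vanish fH => //; lia.
Qed.

(* The conditions for f, f^[s], ..., f^[s(h-1)] say that the pairs {m, m + h} are
   linked and that one coefficient of each pair vanishes. *)
Lemma gab_dim_lt_half C G h : n = h.*2 -> (\dim C < n)%N ->
    (forall f, f \in C -> cf n.-1 f = 0) ->
    (forall f, f \in C -> (cf 0 f == 0) = (cf h f == 0)) ->
  (G <= C)%VS -> is_gen_gabidulin G -> (\dim G < h)%N.
Proof.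
move=> nE ltC C_last C_pair GC gabG; rewrite ltnNge; apply/negP => le_h.
have ltG := leq_ltn_trans (dimvS GC) ltC.
have [s [f [co_s f_surj inG]]] := gen_gabidulin_struct gabG ltG.
have inC i : (i < h)%N -> fpow (s * i) f \in C.
  by move=> lt_i; apply: (subvP GC); apply: inG; apply: leq_trans le_h.
have last0 m i : (i < h)%N -> m + s * i = n.-1 %[mod n] -> cf m f = 0.
  move=> lt_i e; apply/eqP; rewrite -(frob_eq0 (s * i)) -cf_fpow (cf_eqmod _ e).
  by rewrite C_last ?inC.
have pair m i : (i < h)%N -> m + s * i = 0 %[mod n] -> (cf m f == 0) = (cf (m + h) f == 0).
  move=> lt_i e; rewrite -(frob_eq0 (s * i)) -cf_fpow (cf_eqmod _ e) C_pair ?inC //.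
  rewrite -[RHS](frob_eq0 (s * i)) -cf_fpow addnAC.
  by rewrite (@cf_eqmod _ _ (m + s * i + h) h) // -modnDml e modnDml.
(* s is odd because it is coprime to n = 2h. *)
have sh : s * h = h %[mod n].
  have s_odd : odd s by move: co_s; rewrite nE -muln2 coprimeMr coprimen2 => /andP[].
  by rewrite -(odd_double_half s) s_odd mulnDl mul1n -doubleMl doubleMr -nE addnC modnMDl.
suff f0 : f = 0.
  have [x] := f_surj 1; rewrite f0 lpeval0 => /esym/eqP.
  by rewrite oner_eq0.
apply: cf_eq0 => m lt_m.
(* [t] solves m + s t = n - 1. If t >= h, then t - h serves m + h instead, since s h = h modulo n;
   the vanishing is then carried back to m by the pairing, with [t'] solving m + s t' = 0. *)
have [t lt_t e] := coprime_solve (n.-1 + n - m) co_s.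
have [lt_th|le_ht] := ltnP t h.
  apply: (last0 _ _ lt_th); rewrite -modnDmr -e modnDmr subnKC; last by clear -lt_m; lia.
  by rewrite modnDr.
have mh0 : cf (m + h) f = 0.
  apply: (last0 _ (t - h)%N); first by clear -lt_t le_ht nE; lia.
  apply/eqP; rewrite -(eqn_modDr (s * h)) -addnA -mulnDr subnK //; apply/eqP.
  rewrite -modnDmr -e modnDmr -[RHS]modnDmr sh modnDmr.
  by rewrite (_ : m + h + (n.-1 + n - m) = n.-1 + h + n)%N ?modnDr //; clear -lt_m; lia.
have [t' lt_t' e'] := coprime_solve (n - m) co_s.
apply/eqP; have [lt_th'|le_ht'] := ltnP t' h.
  by rewrite (pair _ _ lt_th') ?mh0 // -modnDmr -e' modnDmr subnKC ?modnn ?mod0n // ltnW.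
have e2 : m + h + s * (t' - h) = 0 %[mod n].
  apply/eqP; rewrite -(eqn_modDr (s * h)) -addnA -mulnDr subnK //; apply/eqP.
  rewrite -modnDmr -e' modnDmr add0n sh.
  by rewrite (_ : m + h + (n - m) = h + n)%N ?modnDr //; clear -lt_m; lia.
have <- : cf (m + h + h) f = cf m f.
  by apply: cf_eqmod; rewrite -addnA addnn -nE modnDr.
have lt_h : (t' - h < h)%N by clear -lt_t' le_ht' nE; lia.
by rewrite -(pair _ _ lt_h e2) mh0.
Qed.

Lemma dim_span_lt (X : seq LP) : (size X < n)%N -> (\dim <<X>> < n)%N.
Proof. exact/leq_ltn_trans/dim_span. Qed.

Lemma finField_two_neq0 : odd q -> (2%:R : F) != 0.
Proof.
move=> q_odd; apply/eqP => two0.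
have pchar2 : 2%N \in [pchar F] by rewrite inE /= two0 eqxx.
have : (2.-nat q)%N.
  by rewrite /qq -cardsT; have /andP[] := fin_ring_pchar_abelem pchar2.
rewrite odd_2'nat in q_odd => /(pnat_1)/(_ q_odd) q1.
by have := qq_gt1 F; rewrite q1.
Qed.

(* As x^[6] = x, the image of x^[4] - x is killed by x + x^[2] + x^[4], which
   has at most q^4 roots. *)
Lemma rk_frob4_sub : n = 6%N -> (rk (mon 4 - mon 0) <= 4)%N.
Proof.
move=> n6; rewrite leqNgt /rk; apply/negP; set V := limg _ => lt_V.
pose fT : finFieldType := finvect_type L.
pose s : seq fT := enum (fun x : fT => x \in V).
have size_s : (q ^ 5 <= size s)%N.
  by rewrite /s -(@cardE fT) (@card_vspace F fT _ V) leq_exp2l ?finNzRing_gt1.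
(* These are the coefficients of x + x^[2] + x^[4], padded to length 5. *)
pose a i : L := (~~ odd i)%:R.
suff /(_ 0%N isT)/eqP : forall i, (i < 5)%N -> a i = 0 by rewrite /a /= oner_eq0.
apply: (@lpeval_root_bound F L 5 a s (enum_uniq _) size_s) => x xs.
have /memv_imgP[y _ ->] : x \in V := etrans (esym (mem_enum (fun z : fT => z \in V) x)) xs.
rewrite lfunE /=.
have frob6 i : y ^+ (q ^ (i + 6)) = y ^+ (q ^ i).
  by rewrite -(frob_mod (i + 6)) -n6 modnDr frob_mod.
rewrite !big_ord_recr big_ord0 /= /a /= !(mulr0n, mulr1n, mul0r, mul1r, add0r, addr0).
rewrite lpevalD -scaleN1r lpevalZ mulN1r !lpeval_mon !expr1 !frobD !frobN !frob_comp.
rewrite (frob6 0%N) (frob6 2%N) expr1; ring.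
Qed.

(** For delta = 0 the code contains x^[4] - x, of rank at most 4, while an MRD code of dimension at
    most 2 in degree 6 has minimum distance at least 5. This is how the MRD condition acts in
    (h). *)
Lemma MRD_delta_neq0 delta : n = 6%N ->
  MRD (span [:: mon 0; delta *: mon 1 + mon 4]) -> delta != 0.
Proof.
move=> n6 [d [[_ min_d] card_eq]]; apply/eqP => delta0.
set C := span _ in min_d card_eq.
have le_C : (\dim C <= 2)%N by exact: dim_span.
move: card_eq; rewrite -expnM => /eqP; rewrite eqn_exp2l ?qq_gt1 //.
rewrite eqn_pmul2l ?nn_gt0 // => /eqP dimC.
suff : (d <= 4)%N by move: le_C; rewrite dimC; clear -n6; lia.
apply: leq_trans (rk_frob4_sub n6); apply: min_d.
  rewrite rpredB // memv_span // inE ?eqxx // delta0 scale0r add0r mem_seq1.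
  by rewrite eqxx orbT.
apply/eqP => /(congr1 (cf 4)); rewrite linearB linear0 /= !cf_mon n6 eqxx subr0.
by move/eqP; rewrite oner_eq0.
Qed.

End Families.

(** * Sporadic codes in degrees 6 and 8 *)

Ltac cf_compute n_eq :=
  rewrite ?(linearD, linearN, linearZ) /= ?cf_mon ?n_eq /modn /=.

Ltac cf_generators n_eq :=
  let v := fresh "v" in
  move=> v; rewrite !inE; do ?[case/orP]; move/eqP->; cf_compute n_eq; ring.

Ltac cf_cases n_eq :=
  let m := fresh "m" in let lt_m := fresh "lt_m" in
  apply: cf_eq0 => m lt_m;
  move: {lt_m}(leq_trans lt_m (eq_leq n_eq));
  do 8?[case: m => [|m] //] => _.

Section Degree6.
Variables (F : finFieldType) (L : fieldExtType F).
Local Notation q := (qq F).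
Local Notation n := (nn L).
Local Notation LP := 'rV[L]_n.
Local Notation mon := (mon L).
Implicit Types (f g : LP) (x y : L) (C D G : {vspace LP}).
Hypothesis n6 : n = 6%N.

Lemma coprime6 j : (0 < j < n)%N -> coprime j n -> j = 1%N \/ j = 5%N.
Proof. by rewrite n6; do 6?[case: j => [|j] //]; [left | right]. Qed.

(** With the congruence as a closed boolean, each instance is settled by computation. *)
Lemma eq_mod6 j f g :
    (forall m k, k = m + j %[mod n] -> cf k f = cf m g ^+ (q ^ j)) ->
  forall m k, (k == m + j %[mod 6]) -> cf k f = cf m g ^+ (q ^ j).
Proof. by move=> fg m k /eqP e; apply: fg; rewrite n6. Qed.

Lemma C1_index delta :
  gab_index_is (span [:: mon 0; delta *: mon 1 + mon 4]) 1 /\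
  hC (span [:: mon 0; delta *: mon 1 + mon 4]) = 0%N.
Proof.
set C := span _.
have f1 f : f \in C -> cf 1 f = delta * cf 4 f by apply: span_cf_eq; cf_generators n6.
have f2 f : f \in C -> cf 2 f = 0 by apply: (span_vanish (phi := cf 2)); cf_generators n6.
have f3 f : f \in C -> cf 3 f = 0 by apply: (span_vanish (phi := cf 3)); cf_generators n6.
have f5 f : f \in C -> cf 5 f = 0 by apply: (span_vanish (phi := cf 5)); cf_generators n6.
apply: (@gab_index_hC_succ _ _ C 1 1 (mon 0)); rewrite ?n6 ?coprime1n //.
- by apply: dim_span_lt; rewrite /= n6.
- exact: mon_invertible.
- by case=> // _; rewrite fpow_mon memv_span // inE eqxx.
apply: hC_le => j lt_j co_j; exists [::] => // f g fC gC /eq_mod6 fg _.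
case: (coprime6 lt_j co_j) => ej; subst j.
  have e4 : cf 4 f = 0 by rewrite (fg 3 4 isT)%N f3 ?frob0.
  have e1 : cf 1 f = 0 by rewrite f1 // e4 mulr0.
  have e0 : cf 0 f = 0 by rewrite (fg 5 0 isT)%N f5 ?frob0.
  by cf_cases n6; rewrite ?f2 ?f3 ?f5.
have e4 : cf 4 f = 0 by rewrite (fg 5 4 isT)%N f5 ?frob0.
have e1 : cf 1 f = 0 by rewrite f1 // e4 mulr0.
have g4 : cf 4 g = 0 by apply/eqP; rewrite -(frob_eq0 5) -(fg 4 3 isT)%N f3.
have e0 : cf 0 f = 0 by rewrite (fg 1 0 isT)%N f1 // g4 mulr0 frob0.
by cf_cases n6; rewrite ?f2 ?f3 ?f5.
Qed.

Lemma C2_index (d : L) :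
  gab_index_is (span [:: mon 0; mon 1 + mon 3 + d *: mon 5]) 1 /\
  hC (span [:: mon 0; mon 1 + mon 3 + d *: mon 5]) = 0%N.
Proof.
set C := span _.
have f2 f : f \in C -> cf 2 f = 0 by apply: (span_vanish (phi := cf 2)); cf_generators n6.
have f4 f : f \in C -> cf 4 f = 0 by apply: (span_vanish (phi := cf 4)); cf_generators n6.
have f31 f : f \in C -> cf 3 f = 1 * cf 1 f by apply: span_cf_eq; cf_generators n6.
have f51 f : f \in C -> cf 5 f = d * cf 1 f by apply: span_cf_eq; cf_generators n6.
apply: (@gab_index_hC_succ _ _ C 1 1 (mon 0)); rewrite ?n6 ?coprime1n //.
- by apply: dim_span_lt; rewrite /= n6.
- exact: mon_invertible.
- by case=> // _; rewrite fpow_mon memv_span // inE eqxx.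
apply: hC_le => j lt_j co_j; exists [::] => // f g fC gC /eq_mod6 fg _.
suff [e0 e1] : cf 0 f = 0 /\ cf 1 f = 0.
  by cf_cases n6; rewrite ?f2 ?f31 ?f4 ?f51 ?e1 ?mulr0.
case: (coprime6 lt_j co_j) => ej; subst j.
  have g1 : cf 1 g = 0 by apply/eqP; rewrite -(frob_eq0 1) -(fg 1 2 isT)%N f2.
  split; first by rewrite (fg 5 0 isT)%N f51 // g1 mulr0 frob0.
  by rewrite -[LHS]mul1r -f31 // (fg 2 3 isT)%N f2 ?frob0.
have g3 : cf 3 g = 0 by apply/eqP; rewrite -(frob_eq0 5) -(fg 3 2 isT)%N f2.
split; last by rewrite (fg 2 1 isT)%N f2 ?frob0.
by rewrite (fg 1 0 isT)%N -[cf 1 g]mul1r -f31 // g3 frob0.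
Qed.

(** The generator x - d x^[3] links the coefficients 0 and 3, and coefficient 5 is missing: this is
    the situation of [gab_dim_lt_half] with h = 3. *)
Lemma D1_index d : d != 0 ->
  gab_index_is (span [:: mon 1; mon 2; mon 4; mon 0 - d *: mon 3]) 2 /\
  hC (span [:: mon 1; mon 2; mon 4; mon 0 - d *: mon 3]) = 2%N.
Proof.
move=> d0; set C := span _.
have f5 f : f \in C -> cf 5 f = 0 by apply: (span_vanish (phi := cf 5)); cf_generators n6.
have f3 f : f \in C -> cf 3 f = - d * cf 0 f by apply: span_cf_eq; cf_generators n6.
have fpair f : f \in C -> (cf 0 f == 0) = (cf 3 f == 0).
  by move=> fC; rewrite f3 // mulf_eq0 oppr_eq0 (negbTE d0).
have ltC : (\dim C < n)%N by apply: dim_span_lt; rewrite /= n6.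
have C1 : mon 1 \in C by rewrite memv_span // !inE eqxx.
have C2 : mon 2 \in C by rewrite memv_span // !inE eqxx orbT.
have C4 : mon 4 \in C by rewrite memv_span // !inE eqxx !orbT.
have C03 : mon 0 - d *: mon 3 \in C by rewrite memv_span // !inE eqxx !orbT.
split; first split.
- apply: (gab_subcode (f := mon 1) (coprime1n _)); rewrite ?n6 //.
    exact: mon_invertible.
  by case=> [|[|]] // _; rewrite fpow_mon.
- move=> G GC gabG; rewrite -ltnS.
  have n5 : n.-1 = 5%N by rewrite n6.
  by apply: (@gab_dim_lt_half _ _ C G 3) => //; rewrite n5.
apply/eqP; rewrite eqn_leq; apply/andP; split.
  apply: hC_le => j lt_j co_j; case: (coprime6 lt_j co_j) => ej; subst j.
    exists [:: 1; 2]%N => // f g fC gC /eq_mod6 fg f0.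
    have e1 : cf 1 f = 0 by rewrite f0 ?inE.
    have e2 : cf 2 f = 0 by rewrite f0 ?inE.
    have e0 : cf 0 f = 0 by rewrite (fg 5 0 isT)%N f5 ?frob0.
    have g0 : cf 0 g = 0 by apply/eqP; rewrite -(frob_eq0 1) -(fg 0 1 isT)%N e1.
    have e4 : cf 4 f = 0 by rewrite (fg 3 4 isT)%N f3 // g0 mulr0 frob0.
    by cf_cases n6; rewrite ?f5 ?f3 ?e0 ?mulr0.
  exists [:: 0; 1]%N => // f g fC gC /eq_mod6 fg f0.
  have e0 : cf 0 f = 0 by rewrite f0 ?inE.
  have e1 : cf 1 f = 0 by rewrite f0 ?inE.
  have e4 : cf 4 f = 0 by rewrite (fg 5 4 isT)%N f5 ?frob0.
  have g0 : cf 0 g = 0 by apply/eqP; rewrite -(frob_eq0 5) -(fg 0 5 isT)%N f5.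
  have e2 : cf 2 f = 0 by rewrite (fg 3 2 isT)%N f3 // g0 mulr0 frob0.
  by cf_cases n6; rewrite ?f5 ?f3 ?e0 ?mulr0.
apply: (@hC_ge_dim _ _ C 1); rewrite ?n6 ?coprime1n //.
apply: (@dim_ge F L 2 (nth 0 [:: mon 2; fpow 1 (mon 0 - d *: mon 3)]) (nth 0%N [:: 2; 1]%N)).
  case=> [|[|]] // _; rewrite memv_cap /=; apply/andP; split=> //.
  - by apply/mem_cpow; exists (mon 1); rewrite ?fpow_mon.
  - by rewrite fpowD -scaleNr fpowZ !fpow_mon rpredD ?rpredZ.
  - by apply/mem_cpow; exists (mon 0 - d *: mon 3).
by case=> [|[|]] // [|[|]] // _ _; rewrite /=;
  rewrite ?fpowD -?scaleNr ?fpowZ ?fpow_mon; cf_compute n6; ring.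
Qed.


(* The inverse of x^[2] - d x is (x^[4] + d x^[2] + d^2 x) / (1 - d^3), and
   d^3 = 2 d - 1 differs from 1. *)
Lemma D2_generator_invertible (delta : F) : odd q -> delta ^+ 2 + delta = 1 ->
  lpinvertible (mon 3 - delta%:A *: mon 1).
Proof.
move=> q_odd delta_eq; set d := delta%:A.
have c_neq0 : 1 - delta ^+ 3 != 0.
  have -> : 1 - delta ^+ 3 = 2%:R * (1 - delta).
    transitivity (2%:R * (1 - delta) - (delta ^+ 2 + delta - 1) * (delta - 1)); first by ring.
    by rewrite delta_eq subrr mul0r subr0.
  rewrite mulf_neq0 ?finField_two_neq0 // subr_eq0; apply: contra_eq_neq delta_eq => <-.
  by rewrite expr1n -subr_eq0 addrK oner_eq0.
pose c : L := ((1 - delta ^+ 3)^-1)%:A.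
have cE : c * (1 - d ^+ 3) = 1.
  rewrite exprZn expr1n -[X in X - _]scale1r -scalerBl -scalerAl mul1r.
  by rewrite scalerA mulVf // scale1r.
have frob_d i : d ^+ (q ^ i) = d by apply: frob_scalar.
have frob_d2 i : (d ^+ 2) ^+ (q ^ i) = d ^+ 2 by rewrite exprAC frob_d.
have frob_c i : c ^+ (q ^ i) = c by apply: frob_scalar.
have frob6 x i : x ^+ (q ^ (i + 6)) = x ^+ (q ^ i).
  by rewrite -(frob_mod (i + 6)) -n6 modnDr frob_mod.
have f12 x : x ^+ (q ^ 12) = x by rewrite (frob6 x 6%N) (frob6 x 0%N) expr1.
(* The generator is (x^[2] - d x) o x^[1], so the inverse is preceded by x^[5] = x^[-1]; this shifts
   the exponents 4, 2, 0 to 9, 7, 5. *)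
apply: (@cancel_lpinvertible _ _ _ (c *: (mon 9 + d *: mon 7 + d ^+ 2 *: mon 5))) => x.
  rewrite lpevalZ !lpevalD -scaleNr !lpevalZ !lpeval_mon.
  rewrite !(frobD, exprMn, frobN, frob_d, frob_comp) f12 (frob6 x 0%N) expr1.
  by rewrite -[RHS]mul1r -cE; ring.
rewrite lpevalZ !lpevalD -scaleNr !lpevalZ !lpeval_mon.
rewrite !(frobD, exprMn, frobN, frob_d, frob_d2, frob_c, frob_comp).
rewrite f12 (frob6 x 0%N) expr1.
by rewrite -[RHS]mul1r -cE; ring.
Qed.

(** On the code a_5 = 0 and a_0 + a_2 + d a_4 = 0, and shifts keep the coefficient d because it lies
    in F. The chain of length 2 starts at x^[3] - d x^[1]; a third term is excluded by d != 1. *)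
Lemma D2_index (delta : F) : odd q -> delta ^+ 2 + delta = 1 ->
  gab_index_is (span [:: mon 1; mon 3; mon 0 - mon 2; mon 4 - delta%:A *: mon 0]) 2 /\
  hC (span [:: mon 1; mon 3; mon 0 - mon 2; mon 4 - delta%:A *: mon 0]) = 2%N.
Proof.
move=> q_odd delta_eq; have inv_g := D2_generator_invertible q_odd delta_eq.
have frob_d i : (delta%:A : L) ^+ (q ^ i) = delta%:A by apply: frob_scalar.
have d_neq1 : delta%:A != 1 :> L.
  apply: contra_eq_neq delta_eq => /eqP; rewrite -[X in _ == X]scale1r -subr_eq0 -scalerBl.
  rewrite scaler_eq0 oner_eq0 orbF subr_eq0 => /eqP->.
  by rewrite expr1n -subr_eq0 addrK oner_eq0.
move: inv_g frob_d d_neq1; set d := delta%:A => inv_g frob_d d_neq1; set C := span _.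
have f5 f : f \in C -> cf 5 f = 0 by apply: (span_vanish (phi := cf 5)); cf_generators n6.
have rel f : f \in C -> cf 0 f + cf 2 f + d * cf 4 f = 0.
  pose phi f := cf 0 f + cf 2 f + d * cf 4 f.
  have phi_lin : scalar phi by move=> a u v; rewrite /phi !(cfD, cfZ); ring.
  pose phiL : {scalar LP} := HB.pack phi (GRing.isLinear.Build L LP L *%R phi phi_lin).
  by apply: (span_vanish (phi := phiL)); rewrite /= /phi; cf_generators n6.
have ltC : (\dim C < n)%N by apply: dim_span_lt; rewrite /= n6.
have C1 : mon 1 \in C by rewrite memv_span // !inE eqxx.
have C3 : mon 3 \in C by rewrite memv_span // !inE eqxx orbT.
have C02 : mon 0 - mon 2 \in C by rewrite memv_span // !inE eqxx !orbT.
have C40 : mon 4 - d *: mon 0 \in C by rewrite memv_span // !inE eqxx !orbT.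
have g0 : mon 3 - d *: mon 1 \in C by rewrite rpredB ?rpredZ.
have shift1 : fpow 1 (mon 0 - mon 2) = mon 1 - mon 3.
  by rewrite fpowD -scaleN1r fpowZ !fpow_mon frobN expr1n scaleN1r.
have shift2 : fpow 1 (mon 3 - d *: mon 1) = mon 4 - d *: mon 2.
  by rewrite fpowD -scaleNr fpowZ !fpow_mon frobN frob_d scaleNr.
have g1 : mon 4 - d *: mon 2 \in C.
  have -> : mon 4 - d *: mon 2 = (mon 4 - d *: mon 0) + d *: (mon 0 - mon 2).
    by rewrite scalerBr addrA subrK.
  by rewrite rpredD ?rpredZ.
split; first split.
- apply: (gab_subcode (f := mon 3 - d *: mon 1) (coprime1n _)); rewrite ?n6 //.
  case=> [|[|]] // _; last by rewrite shift2.
  rewrite (_ : fpow _ _ = mon 3 - d *: mon 1) //.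
  by apply: lpeval_inj => x; rewrite lpeval_fpow expr1.
- move=> G GC gabG; rewrite leqNgt; apply/negP => lt_G.
  have ltG := leq_ltn_trans (dimvS GC) ltC.
  have [s [f [co_s f_surj inG]]] := gen_gabidulin_struct gabG ltG.
  suff f0 : f = 0.
    have [x] := f_surj 1; rewrite f0 lpeval0 => /esym/eqP.
    by rewrite oner_eq0.
  pose t := (s %% n)%N; have co_t : coprime t n by rewrite coprime_modl.
  have t_range : (0 < t < n)%N.
    rewrite ltn_mod nn_gt0 andbT lt0n; apply: contraTneq co_t => ->.
    by rewrite /coprime gcd0n n6.
  have inC i : (i < 3)%N -> fpow (t * i) f \in C.
    move=> lt_i; rewrite -fpow_mod modnMml fpow_mod; apply: (subvP GC); apply: inG.
    exact: leq_trans lt_G.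
  have fg i m k : (k == m + t * i %[mod 6]) -> cf k (fpow (t * i) f) = cf m f ^+ (q ^ (t * i)).
    by move/eqP=> e; rewrite -cf_fpow; apply: cf_eqmod; rewrite n6.
  have zero i m : (i < 3)%N -> (5 == m + t * i %[mod 6]) -> cf m f = 0.
    by move=> lt_i /fg e; apply/eqP; rewrite -(frob_eq0 (t * i)) -e f5 ?inC.
  have relf i m0 m2 m4 : (i < 3)%N -> (0 == m0 + t * i %[mod 6]) ->
      (2 == m2 + t * i %[mod 6]) -> (4 == m4 + t * i %[mod 6]) ->
      cf m0 f + cf m2 f + d * cf m4 f = 0.
    move=> lt_i /fg e0 /fg e2 /fg e4; apply/eqP; rewrite -(frob_eq0 (t * i)).
    by rewrite !frobD exprMn frob_d -e0 -e2 -e4 rel ?inC.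
  case: (coprime6 t_range co_t) => et; rewrite {}et in zero relf.
    have z5 := zero 0%N 5%N isT isT; have z4 := zero 1%N 4%N isT isT.
    have z3 := zero 2%N 3%N isT isT.
    have r0 := relf 0%N 0%N 2%N 4%N isT isT isT isT.
    have r1 := relf 1%N 5%N 1%N 3%N isT isT isT isT.
    have r2 := relf 2%N 4%N 0%N 2%N isT isT isT isT.
    have z1 : cf 1 f = 0 by move: r1; rewrite z5 z3 mulr0 add0r addr0.
    have z2 : cf 2 f = - cf 0 f.
      by move/eqP: r0; rewrite z4 mulr0 addr0 addrC addr_eq0 => /eqP.
    (* Given a_4 = 0, the relations for i = 0 and i = 2 are a_0 + a_2 = 0 and a_0 + d a_2 = 0. *)
    have z0 : cf 0 f = 0.
      have : (d - 1) * cf 0 f = 0.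
        transitivity (d * (cf 0 f + cf 2 f + d * cf 4 f) - (cf 4 f + cf 0 f + d * cf 2 f)).
          by rewrite z4; ring.
        by rewrite r0 r2 mulr0 subrr.
      by move/eqP; rewrite mulf_eq0 subr_eq0 (negbTE d_neq1) => /eqP.
    by cf_cases n6; rewrite ?z0 ?z1 ?z2 ?z0 ?oppr0 ?z3 ?z4 ?z5.
  have z5 := zero 0%N 5%N isT isT; have z0 := zero 1%N 0%N isT isT.
  have z1 := zero 2%N 1%N isT isT.
  have r0 := relf 0%N 0%N 2%N 4%N isT isT isT isT.
  have r1 := relf 1%N 1%N 3%N 5%N isT isT isT isT.
  have r2 := relf 2%N 2%N 4%N 0%N isT isT isT isT.
  have z3 : cf 3 f = 0 by move: r1; rewrite z1 z5 mulr0 add0r addr0.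
  have z4 : cf 4 f = 0.
    have : (d - 1) * cf 4 f = 0.
      transitivity ((cf 0 f + cf 2 f + d * cf 4 f) - (cf 2 f + cf 4 f + d * cf 0 f)).
        by rewrite z0; ring.
      by rewrite r0 r2 subrr.
    by move/eqP; rewrite mulf_eq0 subr_eq0 (negbTE d_neq1) => /eqP.
  have z2 : cf 2 f = 0 by move: r2; rewrite z4 z0 mulr0 !addr0.
  by cf_cases n6.
apply/eqP; rewrite eqn_leq; apply/andP; split.
  apply: hC_le => j lt_j co_j.
  have frel g : g \in C -> cf 0 g ^+ (q ^ j) + cf 2 g ^+ (q ^ j) + d * cf 4 g ^+ (q ^ j) = 0.
    by move=> gC; rewrite -(frob_d j) -exprMn -!frobD rel // frob0.
  case: (coprime6 lt_j co_j) => ej; subst j.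
    exists [:: 1; 4]%N => // f g fC gC /eq_mod6 fg f0.
    have e1 : cf 1 f = 0 by rewrite f0 ?inE.
    have e4 : cf 4 f = 0 by rewrite f0 ?inE.
    have e0 : cf 0 f = 0 by rewrite (fg 5 0 isT)%N f5 ?frob0.
    have e2 : cf 2 f = 0 by have := rel f fC; rewrite e0 e4 mulr0 add0r addr0.
    have e3 : cf 3 f = 0.
      have := frel g gC; rewrite -(fg 0 1 isT)%N -(fg 2 3 isT)%N -(fg 4 5 isT)%N.
      by rewrite e1 f5 // mulr0 add0r addr0.
    by cf_cases n6; rewrite ?f5.
  exists [:: 0; 3]%N => // f g fC gC /eq_mod6 fg f0.
  have e0 : cf 0 f = 0 by rewrite f0 ?inE.
  have e3 : cf 3 f = 0 by rewrite f0 ?inE.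
  have e4 : cf 4 f = 0 by rewrite (fg 5 4 isT)%N f5 ?frob0.
  have e2 : cf 2 f = 0 by have := rel f fC; rewrite e0 e4 mulr0 add0r addr0.
  have e1 : cf 1 f = 0.
    have := frel g gC; rewrite -(fg 0 5 isT)%N -(fg 2 1 isT)%N -(fg 4 3 isT)%N.
    by rewrite e3 f5 // mulr0 add0r addr0.
  by cf_cases n6; rewrite ?f5.
apply: (@hC_ge_dim _ _ C 1); rewrite ?n6 ?coprime1n //.
apply: (@dim_ge F L 2 (nth 0 [:: mon 1 - mon 3; mon 4 - d *: mon 2]) (nth 0%N [:: 1; 4]%N)).
  have C13 : mon 1 - mon 3 \in C by rewrite rpredB.
  case=> [|[|]] // _; rewrite memv_cap /=; apply/andP; split=> //.
  - by apply/mem_cpow; exists (mon 0 - mon 2).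
  - by apply/mem_cpow; exists (mon 3 - d *: mon 1).
by case=> [|[|]] // [|[|]] // _ _; rewrite /=; cf_compute n6; ring.
Qed.

End Degree6.

(** * Codes of degree 8 *)

Section Degree8.
Variables (F : finFieldType) (L : fieldExtType F).
Local Notation q := (qq F).
Local Notation n := (nn L).
Local Notation LP := 'rV[L]_n.
Local Notation mon := (mon L).
Implicit Types (f g : LP) (x y : L) (C D G : {vspace LP}).
Hypothesis n8 : n = 8%N.

Lemma coprime8 j : (0 < j < n)%N -> coprime j n ->
  [\/ j = 1%N, j = 3%N, j = 5%N | j = 7%N].
Proof. by rewrite n8; do 8?[case: j => [|j] //]; constructor. Qed.

Lemma eq_mod8 j f g :
    (forall m k, k = m + j %[mod n] -> cf k f = cf m g ^+ (q ^ j)) ->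
  forall m k, (k == m + j %[mod 8]) -> cf k f = cf m g ^+ (q ^ j).
Proof. by move=> fg m k /eqP e; apply: fg; rewrite n8. Qed.

Lemma C4_index d : d != 0 ->
  gab_index_is (span [:: mon 0; d *: mon 1 + mon 5]) 1 /\
  hC (span [:: mon 0; d *: mon 1 + mon 5]) = 0%N.
Proof.
move=> d0; set C := span _.
have f1 f : f \in C -> cf 1 f = d * cf 5 f by apply: span_cf_eq; cf_generators n8.
have f2 f : f \in C -> cf 2 f = 0 by apply: (span_vanish (phi := cf 2)); cf_generators n8.
have f3 f : f \in C -> cf 3 f = 0 by apply: (span_vanish (phi := cf 3)); cf_generators n8.
have f4 f : f \in C -> cf 4 f = 0 by apply: (span_vanish (phi := cf 4)); cf_generators n8.
have f6 f : f \in C -> cf 6 f = 0 by apply: (span_vanish (phi := cf 6)); cf_generators n8.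
have f7 f : f \in C -> cf 7 f = 0 by apply: (span_vanish (phi := cf 7)); cf_generators n8.
have f15 f : f \in C -> (cf 1 f == 0) = (cf 5 f == 0).
  by move=> fC; rewrite f1 // mulf_eq0 (negbTE d0).
apply: (@gab_index_hC_succ _ _ C 1 1 (mon 0)); rewrite ?n8 ?coprime1n //.
- by apply: dim_span_lt; rewrite /= n8.
- exact: mon_invertible.
- by case=> // _; rewrite fpow_mon memv_span // inE eqxx.
apply: hC_le => j lt_j co_j; exists [::] => // f g fC gC /eq_mod8 fg _.
suff [/eqP e0 /eqP e5] : cf 0 f == 0 /\ cf 5 f == 0.
  by cf_cases n8; rewrite ?f1 ?f2 ?f3 ?f4 ?f6 ?f7 ?e5 ?mulr0.
case: (coprime8 lt_j co_j) => ej; subst j.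
- by rewrite (fg 7 0 isT)%N (fg 4 5 isT)%N f7 // f4 // frob0.
- split; last by rewrite (fg 2 5 isT)%N f2 // frob0.
  by rewrite (fg 5 0 isT)%N frob_eq0 -f15 // -(frob_eq0 3) -(fg 1 4 isT)%N f4.
- rewrite -f15 // (fg 3 0 isT)%N (fg 4 1 isT)%N f3 // f4 //.
  by rewrite frob0.
- split; last by rewrite -f15 // (fg 2 1 isT)%N f2 // frob0.
  by rewrite (fg 1 0 isT)%N frob_eq0 f15 // -(frob_eq0 7) -(fg 5 4 isT)%N f4.
Qed.

(** The intersection obeys four conditions: coefficients 7 and 7 + j vanish, 0 is linked to 4, and j
    to 4 + j. Four free positions remain, and j = 1 attains this bound. *)
Lemma D4_index d : d != 0 ->
  gab_index_is
    (span [:: mon 1; mon 2; mon 3; mon 5; mon 6; mon 0 - d *: mon 4]) 3 /\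
  hC (span [:: mon 1; mon 2; mon 3; mon 5; mon 6; mon 0 - d *: mon 4]) = 4%N.
Proof.
move=> d0; set C := span _.
have f7 f : f \in C -> cf 7 f = 0 by apply: (span_vanish (phi := cf 7)); cf_generators n8.
have f4 f : f \in C -> cf 4 f = - d * cf 0 f by apply: span_cf_eq; cf_generators n8.
have f04 f : f \in C -> (cf 0 f == 0) = (cf 4 f == 0).
  by move=> fC; rewrite f4 // mulf_eq0 oppr_eq0 (negbTE d0).
have ltC : (\dim C < n)%N by apply: dim_span_lt; rewrite /= n8.
have C1 : mon 1 \in C by rewrite memv_span // !inE eqxx.
have C2 : mon 2 \in C by rewrite memv_span // !inE eqxx !orbT.
have C3 : mon 3 \in C by rewrite memv_span // !inE eqxx !orbT.
have C5 : mon 5 \in C by rewrite memv_span // !inE eqxx !orbT.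
have C6 : mon 6 \in C by rewrite memv_span // !inE eqxx !orbT.
have C04 : mon 0 - d *: mon 4 \in C by rewrite memv_span // !inE eqxx !orbT.
split; first split.
- apply: (gab_subcode (f := mon 1) (coprime1n _)); rewrite ?n8 //.
    exact: mon_invertible.
  by case=> [|[|[|]]] // _; rewrite fpow_mon.
- move=> G GC gabG; rewrite -ltnS.
  have n7 : n.-1 = 7%N by rewrite n8.
  by apply: (@gab_dim_lt_half _ _ C G 4) => //; rewrite n7.
apply/eqP; rewrite eqn_leq; apply/andP; split.
  apply: hC_le => j lt_j co_j.
  have pair f g m k : f \in C -> g \in C ->
      (forall m k, (k == m + j %[mod 8]) -> cf k f = cf m g ^+ (q ^ j)) ->
      (m == 0 + j %[mod 8]) -> (k == 4 + j %[mod 8]) -> (cf m f == 0) = (cf k f == 0).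
    by move=> fC gC fg /fg-> /fg->; rewrite !frob_eq0 f04.
  case: (coprime8 lt_j co_j) => ej; subst j.
  - exists [:: 1; 2; 3; 6]%N => // f g fC gC /eq_mod8 fg f0.
    have [e1 e2 e3 e6] : [/\ cf 1 f = 0, cf 2 f = 0, cf 3 f = 0 & cf 6 f = 0].
      by split; apply: f0.
    have e0 : cf 0 f = 0 by rewrite (fg 7 0 isT)%N f7 ?frob0.
    have e5 : cf 5 f = 0 by apply/eqP; rewrite -(pair f g 1%N 5%N) // ?e1 ?e5.
    by cf_cases n8; rewrite ?f7 ?f4 ?e0 ?mulr0.
  - exists [:: 0; 1; 5; 6]%N => // f g fC gC /eq_mod8 fg f0.
    have [e0 e1 e5 e6] : [/\ cf 0 f = 0, cf 1 f = 0, cf 5 f = 0 & cf 6 f = 0].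
      by split; apply: f0.
    have e2 : cf 2 f = 0 by rewrite (fg 7 2 isT)%N f7 ?frob0.
    have e3 : cf 3 f = 0 by apply/eqP; rewrite (pair f g 3%N 7%N) // f7.
    by cf_cases n8; rewrite ?f7 ?f4 ?e0 ?mulr0.
  - exists [:: 1; 2; 3; 6]%N => // f g fC gC /eq_mod8 fg f0.
    have [e1 e2 e3 e6] : [/\ cf 1 f = 0, cf 2 f = 0, cf 3 f = 0 & cf 6 f = 0].
      by split; apply: f0.
    have e4 : cf 4 f = 0 by rewrite (fg 7 4 isT)%N f7 ?frob0.
    have e0 : cf 0 f = 0 by apply/eqP; rewrite f04 ?e4.
    have e5 : cf 5 f = 0 by apply/eqP; rewrite (pair f g 5%N 1%N) // ?e1 ?e5.
    by cf_cases n8; rewrite ?f7.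
  - exists [:: 0; 1; 2; 5]%N => // f g fC gC /eq_mod8 fg f0.
    have [e0 e1 e2 e5] : [/\ cf 0 f = 0, cf 1 f = 0, cf 2 f = 0 & cf 5 f = 0].
      by split; apply: f0.
    have e6 : cf 6 f = 0 by rewrite (fg 7 6 isT)%N f7 ?frob0.
    have e3 : cf 3 f = 0 by apply/eqP; rewrite -(pair f g 7%N 3%N) // f7.
    by cf_cases n8; rewrite ?f7 ?f4 ?e0 ?mulr0.
have shift : fpow 1 (mon 0 - d *: mon 4) = mon 1 - d ^+ (q ^ 1) *: mon 5.
  by rewrite fpowD -scaleNr fpowZ !fpow_mon frobN scaleNr.
have C15 : mon 1 - d ^+ (q ^ 1) *: mon 5 \in C by rewrite rpredB ?rpredZ.
apply: (@hC_ge_dim _ _ C 1); rewrite ?n8 ?coprime1n //.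
apply: (@dim_ge F L 4 (nth 0 [:: mon 1 - d ^+ (q ^ 1) *: mon 5; mon 2; mon 3; mon 6])
  (nth 0%N [:: 1; 2; 3; 6]%N)).
  case=> [|[|[|[|]]]] // _; rewrite memv_cap /=; apply/andP; split=> //.
  - by apply/mem_cpow; exists (mon 0 - d *: mon 4).
  - by apply/mem_cpow; exists (mon 1); rewrite ?fpow_mon.
  - by apply/mem_cpow; exists (mon 2); rewrite ?fpow_mon.
  - by apply/mem_cpow; exists (mon 5); rewrite ?fpow_mon.
by case=> [|[|[|[|]]]] // [|[|[|[|]]]] // _ _; rewrite /=; cf_compute n8; ring.
Qed.

End Degree8.

(* Only s mod n matters, so that for fixed n the hypotheses of
   [mon_code_index] reduce to a finite computation. *)
Definition mon_code_check (N l e : nat) (T : seq nat) : bool := (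
  all (fun t => let S := [seq (i * t) %% N | i <- T] in
    coprime t N ==>
    all (fun i => (e * t + i * t) %% N \in S) (iota 0 l) &&
    all (fun j => coprime j N ==>
        (size [seq r <- iota 0 N | (r \in S) && (((r + (N - j)) %% N) \in S)] <= l.-1))
      (iota 1 N.-1)) (iota 0 N))%N.

Lemma mon_code_index_mult (F : finFieldType) (L : fieldExtType F) (N s l e : nat)
    (T : seq nat) :
    nn L = N -> coprime s N -> (1 < N)%N -> (size T < N)%N -> (0 < l)%N ->
    mon_code_check N l e T ->
  let C : {vspace 'rV[L]_(nn L)} := span [seq mon L (i * s)%N | i <- T] in
  gab_index_is C l /\ hC C = l.-1.
Proof.
move=> nN co_s N_gt1 ltT l_gt0 /allP/(_ (s %% N)%N); rewrite mem_iota ltn_mod (ltnW N_gt1).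
rewrite coprime_modl co_s => /(_ isT)/andP[/allP incl /allP cap] C.
have resT : residues L [seq (i * s)%N | i <- T] = [seq ((i * (s %% N)) %% N)%N | i <- T].
  by rewrite /residues -map_comp; apply: eq_map => i /=; rewrite nN modnMmr.
have -> : C = span (map (mon L) [seq (i * s)%N | i <- T]) by rewrite -map_comp.
apply: (@mon_code_index F L _ s l (e * s)); rewrite ?nN ?size_map //.
  move=> i lt_i; rewrite resT (mulnC s) -mulnDl -modnMmr mulnDl; apply: incl.
  by rewrite mem_iota.
move=> j lt_j co_j; rewrite resT; apply: (implyP (cap j _) co_j).
by rewrite mem_iota add1n prednK // ltnW.
Qed.

Theorem theorem4p2 (F : finFieldType) (L : fieldExtType F) :
  let q := qq F in
  let n := nn L in
  let x := mon L in
  (* (a) Gabidulin codes *)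
  (forall k s : nat, coprime s n -> (1 <= k < n)%N ->
     gab_index_is (gab L k s) k /\ hC (gab L k s) = (k - 1)%N) /\
  (* (b) twisted Gabidulin codes H_{k,s}(eta) *)
  (forall (k s : nat) (eta : L), coprime s n -> (1 < k < n - 1)%N -> eta != 0 ->
     normN eta != (-1) ^+ (n * k) :> L ->
     let H := span ((x 0%N + eta *: x (s * k)%N) :: [seq x (s * i)%N | i <- iota 1 (k - 1)]) in
     gab_index_is H (k - 1) /\ hC H = (k - 2)%N) /\
  (* (c) C_1, n = 6 *)
  (forall delta : L, n = 6%N -> (4 < q)%N ->
     let C1 := span ([:: x 0%N; delta *: x 1%N + x 4%N]) in
     MRD C1 -> gab_index_is C1 1 /\ hC C1 = 0%N) /\
  (* (d) C_2, n = 6 *)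
  (forall delta : F, n = 6%N -> odd q -> (q %% 5 \in [:: 0; 1; 4])%N ->
     delta ^+ 2 + delta = 1 ->
     let C2 := span ([:: x 0%N; x 1%N + x 3%N + delta%:A *: x 5%N]) in
     gab_index_is C2 1 /\ hC C2 = 0%N) /\
  (* (e) C_3, n = 7 *)
  (forall s : nat, n = 7%N -> odd q -> coprime s 7 ->
     let C3 := span ([:: x 0%N; x s; x (3 * s)%N]) in
     gab_index_is C3 2 /\ hC C3 = 1%N) /\
  (* (f) C_4, n = 8 *)
  (forall delta : L, n = 8%N -> odd q -> delta ^+ 2 = -1 ->
     let C4 := span ([:: x 0%N; delta *: x 1%N + x 5%N]) in
     gab_index_is C4 1 /\ hC C4 = 0%N) /\
  (* (g) C_5, n = 8 *)
  (forall s : nat, n = 8%N -> (q %% 3 = 1)%N -> coprime s 8 ->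
     let C5 := span ([:: x 0%N; x s; x (3 * s)%N]) in
     gab_index_is C5 2 /\ hC C5 = 1%N) /\
  (* (h) D_1, n = 6, q and delta as in (c) *)
  (forall delta : L, n = 6%N -> (4 < q)%N ->
     MRD (span ([:: x 0%N; delta *: x 1%N + x 4%N])) ->
     let D1 := span ([:: x 1%N; x 2%N; x 4%N; x 0%N - delta ^+ (q ^ 5) *: x 3%N]) in
     gab_index_is D1 2 /\ hC D1 = 2%N) /\
  (* (i) D_2, n = 6, q and delta as in (d) *)
  (forall delta : F, n = 6%N -> odd q -> (q %% 5 \in [:: 0; 1; 4])%N ->
     delta ^+ 2 + delta = 1 ->
     let D2 := span ([:: x 1%N; x 3%N; x 0%N - x 2%N; x 4%N - delta%:A *: x 0%N]) in
     gab_index_is D2 2 /\ hC D2 = 2%N) /\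
  (* (j) D_3, n = 7 *)
  (forall s : nat, n = 7%N -> odd q -> coprime s 7 ->
     let D3 := span ([:: x 0%N; x (2 * s)%N; x (3 * s)%N; x (4 * s)%N]) in
     gab_index_is D3 3 /\ hC D3 = 2%N) /\
  (* (k) D_4, n = 8 *)
  (forall delta : L, n = 8%N -> odd q -> delta ^+ 2 = -1 ->
     let D4 := span ([:: x 1%N; x 2%N; x 3%N; x 5%N; x 6%N; x 0%N - delta *: x 4%N]) in
     gab_index_is D4 3 /\ hC D4 = 4%N) /\
  (* (l) D_5, n = 8 *)
  (forall s : nat, n = 8%N -> (q %% 3 = 1)%N -> coprime s 8 ->
     let D5 := span ([:: x 0%N; x (2 * s)%N; x (3 * s)%N; x (4 * s)%N; x (5 * s)%N]) in
     gab_index_is D5 4 /\ hC D5 = 3%N).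
Proof.
move=> q n x; rewrite /q /n /x => {q n x}.
split; first by move=> k s co_s lt_k; rewrite subn1; apply: gabidulin_index.
split.
  move=> k s eta co_s lt_k eta0 _.
  have [ind_H hC_H] := twisted_gab_index co_s lt_k eta0.
  split; first by move: ind_H; rewrite -subn1.
  by rewrite [LHS]hC_H; lia.
split; first by move=> delta n6 _ _; apply: C1_index.
split; first by move=> delta n6 _ _ _; apply: C2_index.
split.
  move=> s n7 _ co_s.
  (* The arguments 2 and 0 are the length and start of the chain x, x^[s]. *)
  have := @mon_code_index_mult F L 7 s 2 0 [:: 0; 1; 3]%N n7 co_s isT isT isT isT.
  by rewrite /= mul1n.
split.
  move=> delta n8 _ delta2; apply: C4_index => //.
  apply: contra_eq_neq delta2 => ->.
  by rewrite expr0n eq_sym oppr_eq0 oner_eq0.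
split.
  move=> s n8 _ co_s.
  have := @mon_code_index_mult F L 8 s 2 0 [:: 0; 1; 3]%N n8 co_s isT isT isT isT.
  by rewrite /= mul1n.
split.
  move=> delta n6 _ /(MRD_delta_neq0 n6) delta0.
  by apply: D1_index; rewrite ?expf_neq0.
split; first by move=> delta n6 q_odd _ delta_eq; apply: D2_index.
split.
  move=> s n7 _ co_s.
  (* The longest run of consecutive multiples of s in the support starts at 2: x^[2s], x^[3s],
     x^[4s]. *)
  exact: (@mon_code_index_mult F L 7 s 3 2 [:: 0; 2; 3; 4]%N n7 co_s isT isT isT isT).
split.
  move=> delta n8 _ delta2; apply: D4_index => //.
  apply: contra_eq_neq delta2 => ->.
  by rewrite expr0n eq_sym oppr_eq0 oner_eq0.
move=> s n8 _ co_s.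
exact: (@mon_code_index_mult F L 8 s 4 2 [:: 0; 2; 3; 4; 5]%N n8 co_s isT isT isT isT).
Qed.
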